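(* There exists a complex manifold $Y'$ with identically vanishing Kobayashi pseudodistance $d_{Y'}$ whose universal covering is biholomorphic to $$H^+\times\mathbb{C}^3=\{z\in\mathbb{C}^4:\operatorname{Im}(z_1)>0\},$$ where $H^+=\{z\in\mathbb{C}:\operatorname{Im}(z)>0\}$.
   Context: Let $\Delta=\{z\in\mathbb{C}:|z|<1\}$ be the unit disc and let $d_\Delta$ be the Poincaré distance on $\Delta$. For a complex manifold $Y$ and $p,q\in Y$, the Kobayashi pseudodistance $d_Y(p,q)$ is the infimum of $\sum_{i=1}^k d_\Delta(a_i,b_i)$ over all chains of discs from $p$ to $q$, i.e. over all $k\ge 1$, points $p=p_0,p_1,\dots,p_k=q$ of $Y$, points $a_i,b_i\in\Delta$ and holomorphic maps $f_i:\Delta\to Y$ with $f_i(a_i)=p_{i-1}$ and $f_i(b_i)=p_i$. It vanishes identically if $d_Y(p,q)=0$ for all $p,q\in Y$. *)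

(* Defs.v *)
From HB Require Import structures.
From mathcomp Require Import all_boot all_order all_algebra.
From mathcomp Require Import all_classical all_reals all_analysis.
From mathcomp Require Import complex.

Set Implicit Arguments.
Unset Strict Implicit.
Unset Printing Implicit Defensive.

Import Order.TTheory GRing.Theory Num.Theory.
Import numFieldNormedType.Exports.

Local Open Scope classical_set_scope.
Local Open Scope ring_scope.

(* The alias makes Rocq find the norm and topology that MathComp-Analysis puts
   on every [numFieldType]; they are not inferred on [R[i]] itself.  The order
   of [C R] is partial: [0 < e] entails that [e] is real, and [`|z|] is a real
   element of [C R]. *)
Definition C (R : realType) : numClosedFieldType := R[i]%C.

(* A chart is a homeomorphism from the open set [chart_dom] of [T] onto the
   open set [chart_img] of [V].  Both maps are total functions, whose values
   outside these sets are irrelevant. *)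
Record chart (R : realType) (V : normedModType (C R)) (T : topologicalType) :=
  Chart {
    chart_map :> T -> V;
    chart_inv : V -> T;
    chart_dom : set T;
    chart_img : set V;
    chart_dom_open : open chart_dom;
    chart_img_open : open chart_img;
    chart_mapP : forall x, chart_dom x -> chart_img (chart_map x);
    chart_invP : forall z, chart_img z -> chart_dom (chart_inv z);
    chart_mapK : forall x, chart_dom x -> chart_inv (chart_map x) = x;
    chart_invK : forall z, chart_img z -> chart_map (chart_inv z) = z;
    chart_map_continuous :
      forall x, chart_dom x -> {for x, continuous chart_map};
    chart_inv_continuous :
      forall z, chart_img z -> {for z, continuous chart_inv}
  }.

(* [differentiable] is Frechet differentiability over the scalar field [C R];
   at every point of an open set it is holomorphy. *)
Record complexManifold (R : realType) (n : nat) := ComplexManifold {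
  manifold_space :> topologicalType;
  atlas : set (chart 'rV[C R]_n manifold_space);
  atlas_cover : forall x : manifold_space, exists2 c, atlas c & chart_dom c x;
  atlas_compatible : forall c1 c2, atlas c1 -> atlas c2 ->
    forall x, chart_dom c1 x -> chart_dom c2 x ->
      differentiable (c2 \o chart_inv c1) (c1 x);
  manifold_hausdorff : hausdorff_space manifold_space;
  manifold_second_countable : @second_countable manifold_space
}.

Arguments atlas {R n} _.

(* The standard atlas of a normed space, given by the identity chart. *)
Section identity_chart.
Context (R : realType) (V : normedModType (C R)).

Fact id_chartT (x : V) : [set: V] x -> [set: V] x.
Proof. by []. Qed.

Fact id_chartK (x : V) : [set: V] x -> x = x.
Proof. by []. Qed.

Fact id_chart_continuous (x : V) : [set: V] x -> {for x, continuous id}.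
Proof. by move=> _; exact: cvg_id. Qed.

Definition id_chart : chart V V :=
  @Chart R V V id id setT setT openT openT id_chartT id_chartT
    id_chartK id_chartK id_chart_continuous id_chart_continuous.

Definition std_atlas : set (chart V V) := [set id_chart].

End identity_chart.
Arguments std_atlas {R} V.

(* [f] is holomorphic on the open set [U], in the charts of the atlases [AX]
   and [AY].  Only the values of [f] on [U] matter. *)
Definition holomorphic_on (R : realType) (V W : normedModType (C R))
    (X Y : topologicalType) (AX : set (chart V X)) (AY : set (chart W Y))
    (U : set X) (f : X -> Y) : Prop :=
  forall x, U x ->
    {for x, continuous f} /\
    forall c1 c2, AX c1 -> AY c2 -> chart_dom c1 x -> chart_dom c2 (f x) ->
      differentiable (c2 \o f \o chart_inv c1) (c1 x).

(* [f] restricts to a biholomorphic map from the open set [A] onto the open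
   set [B]. *)
Definition biholomorphic_on (R : realType) (V W : normedModType (C R))
    (X Y : topologicalType) (AX : set (chart V X)) (AY : set (chart W Y))
    (A : set X) (B : set Y) (f : X -> Y) : Prop :=
  exists g : Y -> X,
    [/\ forall x, A x -> B (f x) /\ g (f x) = x,
        forall y, B y -> A (g y) /\ f (g y) = y,
        holomorphic_on AX AY A f &
        holomorphic_on AY AX B g].

Definition unit_disc (R : realType) : set (C R) := [set z | `|z| < 1].

(* Normalised to have curvature -1, i.e. induced by the metric
   [2 |dz| / (1 - |z|^2)]. *)
Definition poincare_dist (R : realType) (a b : C R) : R :=
  let r : R := complex.Re `|(a - b) / (1 - b^* * a)| in
  ln ((1 + r) / (1 - r)).

(* The discs are total functions [f i : C R -> Y], of which only the restriction
   to the unit disc is used.  The infimum is taken in [\bar R], so that it is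
   [+oo] when there is no chain from [p] to [q]. *)
Definition kobayashi (R : realType) (n : nat) (Y : complexManifold R n)
    (p q : Y) : \bar R :=
  ereal_inf [set l | exists (k : nat) (P : nat -> Y) (a b : nat -> C R)
                            (f : nat -> C R -> Y),
    [/\ (0 < k)%N, P 0%N = p, P k = q,
        forall i, (i < k)%N ->
          [/\ unit_disc (a i), unit_disc (b i),
              holomorphic_on (std_atlas (C R)) (atlas Y) (@unit_disc R) (f i),
              f i (a i) = P i & f i (b i) = P i.+1] &
        l = (\sum_(i < k) poincare_dist (a i) (b i))%:E]].

Definition path_connected (R : realType) (T : topologicalType) : Prop :=
  forall x y : T, exists g : R -> T,
    [/\ {within `[0, 1], continuous g}, g 0 = x & g 1 = y].

Definition simply_connected (R : realType) (T : topologicalType) : Prop :=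
  [/\ [set: T] !=set0,
      path_connected R T &
      forall g : R -> T, {within `[0, 1], continuous g} -> g 0 = g 1 ->
        exists H : R * R -> T,
          [/\ {within `[0, 1] `*` `[0, 1], continuous H},
              forall t : R, t \in `[0, 1] -> H (0, t) = g t,
              forall t : R, t \in `[0, 1] -> H (1, t) = g 0 &
              forall s : R, s \in `[0, 1] -> H (s, 0) = g 0 /\ H (s, 1) = g 0]].

(* [F] is the family of sheets over [U]. *)
Definition evenly_covered (R : realType) (n m : nat) (X : complexManifold R n)
    (Y : complexManifold R m) (p : X -> Y) (U : set Y) : Prop :=
  exists F : set (set X),
    [/\ F `<=` open,
        trivIset F id,
        p @^-1` U = \bigcup_(V in F) V &
        forall V, F V -> biholomorphic_on (atlas X) (atlas Y) V U p].

Definition holomorphic_covering (R : realType) (n m : nat)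
    (X : complexManifold R n) (Y : complexManifold R m) (p : X -> Y) : Prop :=
  [/\ holomorphic_on (atlas X) (atlas Y) setT p,
      forall y, exists x, p x = y &
      forall y, exists U : set Y, [/\ open U, U y & evenly_covered p U]].

Definition universal_covering (R : realType) (n m : nat)
    (X : complexManifold R n) (Y : complexManifold R m) (p : X -> Y) : Prop :=
  simply_connected R X /\ holomorphic_covering p.

(* [H^+ * C^3] as a domain of [C^4]; the first coordinate has index [0]. *)
Definition halfplane_times_C3 (R : realType) : set 'rV[C R]_4 :=
  [set z | 0 < complex.Im (z ord0 ord0)].

(* Main.v *)
(* Let [x] be a root of the cyclic cubic [X^3 - 3X - 1], with conjugates [x'], [x''].
   The ring [Z[x]] is a lattice in [R^3] under its three real places, and [x] and
   [x^2 - 2] are independent units.  The group [Z^2 |>< Z[x]] acts on [H^+ * C^3] by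
   [(z, w', w'', s) |-> (u z + b, u' w' + b', u'' w'' + b'', s + m + i n)] where
   [u = x^m (x^2 - 2)^n]: the last coordinate determines [(m, n)] and then the lattice
   determines [b], so the action is free and properly discontinuous.  On the first
   coordinate, however, it is by the maps [z |-> u z + b], under which every orbit in
   [H^+] is dense, because the [u] are dense in the positive reals and the [b] in [R].
   So any two points of the quotient have lifts whose first coordinates are arbitrarily
   close, and the [C^3] directions cost nothing. *)

Require Import Defs.
From HB Require Import structures.
From mathcomp Require Import all_boot all_order all_algebra.
From mathcomp Require Import all_classical all_reals all_analysis.
From mathcomp Require Import complex.
From mathcomp Require Import ring lra zify.

Set Implicit Arguments.
Unset Strict Implicit.
Unset Printing Implicit Defensive.

Import Order.TTheory GRing.Theory Num.Theory.
Import numFieldNormedType.Exports.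

Local Open Scope classical_set_scope.
Local Open Scope ring_scope.

(** * Differentiability as a local property *)

Section near_differentiable.
Context (K : numFieldType) (V W : normedModType K).

(** [differentiable] speaks of a chosen differential; one continuous linear approximation [d]
    suffices, because the choice then has the same property. *)
Lemma linear_approx_differentiable (f : V -> W) (d : {linear V -> W}) (x : V) :
  continuous d -> f \o shift x = cst (f x) + d +o_ 0 id -> differentiable f x.
Proof.
move=> cd fd; apply/diffP.
apply: (@getPex _ (fun d : {linear V -> W} => continuous d /\
  forall y, f y = f (lim (nbhs x)) + d (y - lim (nbhs x))
                  +o_(y \near x) (y - lim (nbhs x)))).
exists d; rewrite lim_id//; split=> //.
suff fE : f = (fun y => f x + d (y - x)) +o_ x (center x).
  by apply: eqaddoEx => z; rewrite {1}fE.
move: fd => /eqaddoP fd; apply/eqaddoP => e e0.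
rewrite [\forall y \near _, _ <= _](near_shift 0) subr0.
by apply: filterS (fd e e0) => h; rewrite !fctE /= addrK.
Qed.

(** Serves for maps read in charts, which follow a known formula only near the point at hand. *)
Lemma near_eq_differentiable (f g : V -> W) (x : V) :
  (\forall z \near x, f z = g z) -> differentiable f x -> differentiable g x.
Proof.
move=> fg df.
have fgx : f x = g x by exact: nbhs_singleton fg.
apply: (@linear_approx_differentiable g ('d f x)).
  exact: diff_continuous.
have /eqaddoP h := diff_locally df; apply/eqaddoP => e e0.
have {}fg : \forall z \near 0, f (z + x) = g (z + x).
  by move: fg; rewrite (near_shift 0) subr0.
by near=> z; rewrite !fctE -fgx /= -(near fg z)//; near: z; exact: h.
Unshelve. all: by end_near. Qed.

End near_differentiable.

(** * Quotients by properly discontinuous groups *)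

(* [pd_disc] at [x = y] gives freeness, since [id] is in [G]; at points [x], [y] of
   different orbits it leaves a single translate to be separated from [y]. *)
Record properly_discontinuous (R : realType) (V : normedModType (C R))
    (D : set V) (G : set (V -> V)) : Prop := ProperlyDiscontinuous {
  pd_id : G id;
  pd_comp : forall g h, G g -> G h -> G (g \o h);
  pd_inv : forall g, G g -> exists2 h, G h & cancel g h;
  pd_stable : forall g, G g -> forall z, D z -> D (g z);
  pd_diff : forall g, G g -> forall z, differentiable g z;
  pd_disc : forall x y, D x -> D y -> exists A B : set V,
    [/\ nbhs x A, nbhs y B & forall g h, G g -> G h -> forall u v,
      A u -> A v -> B (g u) -> B (h v) -> g = h]
}.

Section quotient.
Local Open Scope quotient_scope.
Context (R : realType) (V : normedModType (C R)) (T : topologicalType).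
Context (c : chart V T) (G : set (V -> V)).
Hypothesis domT : chart_dom c = setT.
Hypothesis pdG : properly_discontinuous (chart_img c) G.

Local Notation D := (chart_img c).
Local Notation ci := (chart_inv c).

Let imgc x : D (c x). Proof. by apply: chart_mapP; rewrite domT. Qed.
Let cK : cancel c ci. Proof. by move=> x; apply: chart_mapK; rewrite domT. Qed.
Let ciK z : D z -> c (ci z) = z. Proof. exact: chart_invK. Qed.
Let contc : continuous c.
Proof. by move=> x; apply: chart_map_continuous; rewrite domT. Qed.
Let contci z : D z -> {for z, continuous ci}.
Proof. exact: chart_inv_continuous. Qed.
Let contG g : G g -> continuous g.
Proof. by move=> Gg z; apply: differentiable_continuous; exact: (pd_diff pdG). Qed.

Let contact g : G g -> continuous (ci \o g \o c).
Proof.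
move=> Gg x; apply: continuous_comp; first exact: contc.
apply: continuous_comp; first exact: contG.
by apply: contci; exact: (pd_stable pdG).
Qed.

(** [G] acts on the model [V], while the quotient is one of [T]: the action is transported along
    [c]. *)
Definition orbit_rel : rel T := fun x y => `[< exists2 g, G g & g (c x) = c y >].

Fact orbit_rel_refl : reflexive orbit_rel.
Proof. by move=> x; apply/asboolP; exists id => //; exact: (pd_id pdG). Qed.

Fact orbit_rel_sym : symmetric orbit_rel.
Proof.
have h x y : orbit_rel x y -> orbit_rel y x.
  move=> /asboolP[g Gg gxy]; have [k Gk kK] := pd_inv pdG Gg.
  by apply/asboolP; exists k => //; rewrite -gxy kK.
by move=> x y; apply/idP/idP; exact: h.
Qed.

Fact orbit_rel_trans : transitive orbit_rel.
Proof.
move=> y x z /asboolP[g Gg gxy] /asboolP[h Gh hyz]; apply/asboolP.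
by exists (h \o g); [exact: (pd_comp pdG)|rewrite /= gxy].
Qed.

Definition orbit_equiv : equiv_rel T :=
  EquivRel orbit_rel orbit_rel_refl orbit_rel_sym orbit_rel_trans.

Definition orbit_space : topologicalType :=
  quotient_topology {eq_quot orbit_equiv}.

Definition orbit_proj (x : T) : orbit_space :=
  (\pi_(quotient_topology {eq_quot orbit_equiv}) x)%qT.
Local Notation pr := orbit_proj.

Definition orbit_repr (y : orbit_space) : T :=
  repr (y : quotient_topology {eq_quot orbit_equiv}).

Lemma orbit_reprK : cancel orbit_repr pr.
Proof. by move=> y; exact: reprK. Qed.

Lemma orbit_projP x y : pr x = pr y <-> exists2 g, G g & g (c x) = c y.
Proof.
split.
  by move=> /(@eqquotP _ orbit_equiv _ x y)/asboolP.
by move=> h; apply/(@eqquotP _ orbit_equiv _ x y)/asboolP.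
Qed.

Lemma orbit_proj_continuous : continuous pr.
Proof. exact: pi_continuous. Qed.

Lemma orbit_proj_act g z : G g -> D z -> pr (ci (g z)) = pr (ci z).
Proof.
move=> Gg Dz; apply/esym/orbit_projP; exists g => //.
by rewrite !ciK//; exact: (pd_stable pdG).
Qed.

Lemma open_orbit_proj A : open A -> open (pr @` A).
Proof.
move=> oA.
(* Openness in the quotient topology is openness of the preimage, here the union of the preimages of
   [A] under the group elements. *)
have -> : open (pr @` A) = open (pr @^-1` (pr @` A)) by [].
have -> : pr @^-1` (pr @` A) = \bigcup_(g in G) ((ci \o g \o c) @^-1` A).
  apply/seteqP; split => [x [y Ay /esym/orbit_projP[g Gg gxy]]|x [g Gg /= Ag]].
    by exists g => //=; rewrite gxy cK.
  by exists (ci (g (c x))) => //; rewrite orbit_proj_act// cK.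
apply: bigcup_open => g Gg; apply: open_comp => // x _.
exact: contact.
Qed.

Lemma nbhs_orbit_proj x A : nbhs x A -> nbhs (pr x) (pr @` A).
Proof.
rewrite nbhsE => -[B [oB Bx] BA]; apply: filterS (image_subset _ BA) _.
by apply: open_nbhs_nbhs; split; [exact: open_orbit_proj|exists x].
Qed.

Lemma orbit_space_hausdorff : hausdorff_space V -> hausdorff_space orbit_space.
Proof.
move=> hV p q; rewrite -(orbit_reprK p) -(orbit_reprK q).
move: (orbit_repr p) (orbit_repr q) => x y clxy {p q}.
apply/orbit_projP; apply: contrapT => ngxy.
have [A [B [xA yB AB]]] := pd_disc pdG (imgc x) (imgc y).
suff [A' [B' [xA' yB' AB']]] : exists A' B' : set V, [/\ nbhs (c x) A', nbhs (c y) B' &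
    forall g u, G g -> A' u -> B' (g u) -> False].
  have [] := clxy (pr @` (c @^-1` A')) (pr @` (c @^-1` B')).
  - by apply: nbhs_orbit_proj; exact: contc.
  - by apply: nbhs_orbit_proj; exact: contc.
  move=> _ [[u Au <-] [v Bv /esym/orbit_projP[g Gg guv]]].
  by apply: (AB' g (c u)); rewrite ?guv.
(* By [pd_disc] at most one [g] sends a point of [A] into [B]. If there is one, [g (c x)] and [c y]
   are distinct, and shrinking [A] and [B] along disjoint neighbourhoods [U] and [W] of these two
   points excludes it as well. *)
have [[g [u [Gg Au Bgu]]]|nex] := pselect (exists g u, [/\ G g, A u & B (g u)]); last first.
  by exists A, B; split=> // g u Gg Au Bu; apply: nex; exists g, u.
have gxy : g (c x) <> c y by move=> e; apply: ngxy; exists g.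
have [/=[U W]] : exists2 E : set V * set V, (g (c x) \in E.1 /\ c y \in E.2) &
    [/\ open E.1, open E.2 & E.1 `&` E.2 = set0].
  move: hV; rewrite open_hausdorff => /(_ _ _ (introN eqP gxy))[E h1 [h2 h3 /eqP h4]].
  by exists E.
rewrite !inE => -[/= Ux Wy] [oU oW UW].
exists (A `&` g @^-1` U), (B `&` W); split.
- by apply: filterI => //; apply: contG => //; exact: open_nbhs_nbhs.
- by apply: filterI => //; exact: open_nbhs_nbhs.
- move=> h v Gh [Av Uv] [Bhv Whv].
  have gh := AB _ _ Gg Gh _ _ Au Av Bgu Bhv.
  suff : (U `&` W) (g v) by rewrite UW.
  by split=> //; rewrite gh.
Qed.

Lemma orbit_space_second_countable :
  @second_countable T -> @second_countable orbit_space.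
Proof.
move=> [B cB [oB bB]]; exists ((fun A => pr @` A) @` B).
  exact: card_le_trans (card_image_le _ _) cB.
split=> [_ [A BA <-]|]; first exact/open_orbit_proj/oB.
move=> y U; rewrite -(orbit_reprK y); move: (orbit_repr y) => x {y} xU.
have [A [BA Ax] AU] := bB x (pr @^-1` U) (orbit_proj_continuous xU).
exists (pr @` A); first by split; [exists A|exists x].
by move=> _ [z Az <-]; exact: AU.
Qed.

(** The images of these sets are the chart domains of the quotient, and their translates are the
    sheets of the covering. *)
Definition sheet (W : set T) : Prop := open W /\ {in W &, injective pr}.

(** With [x = y] and [h = id] in [pd_disc], an element of [G] carrying one point of [A] and [B] to
    another must be the identity. *)
Lemma sheet_nbhs x : exists2 W, sheet W & W x.
Proof.
have [A [B [xA xB AB]]] := pd_disc pdG (imgc x) (imgc x).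
exists ((c @^-1` (A `&` B))°)%classic; last first.
  by apply: contc; exact: filterI.
split; first exact: open_interior.
move=> u v /set_mem/interior_subset[Au Bu] /set_mem/interior_subset[Av Bv].
move=> /orbit_projP[g Gg guv]; apply: (can_inj cK); rewrite -guv.
have -> // := AB g id Gg (pd_id pdG) _ _ Au Au; by rewrite guv.
Qed.

(* Off [pr @` W] the value is arbitrary. *)
Definition sheet_section (W : set T) (y : orbit_space) : T :=
  xget (orbit_repr y) [set x | W x /\ pr x = y].
Local Notation sec := sheet_section.

Lemma sheet_sectionP W y : (pr @` W) y -> W (sec W y) /\ pr (sec W y) = y.
Proof. by move=> [x Wx xy]; exact: (@xgetI _ _ [set x | W x /\ pr x = y] x). Qed.

Lemma sheet_sectionK W x : sheet W -> W x -> sec W (pr x) = x.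
Proof.
move=> [_ inj] Wx; have [] := @sheet_sectionP W (pr x); first by exists x.
by move=> Ws; apply: inj; exact: mem_set.
Qed.

(** This is openness of the projection: the image of a neighbourhood of [x] within [W] is a
    neighbourhood, which the section carries back. *)
Lemma sheet_section_continuous W y : sheet W -> (pr @` W) y ->
  {for y, continuous (sec W)}.
Proof.
move=> sW [x Wx <-] A; rewrite (sheet_sectionK sW Wx) => xA.
have /nbhs_orbit_proj : nbhs x (A `&` W).
  by apply: filterI => //; apply: open_nbhs_nbhs; split=> //; case: sW.
by apply: filterS => _ [z [Az Wz] <-]; rewrite /= sheet_sectionK.
Qed.

Section sheet_chart.
Context (W : set T) (sW : sheet W).

Let dom := pr @` W.
Let img := [set z | D z /\ W (ci z)].

Fact sheet_chart_dom_open : open dom.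
Proof. by apply: open_orbit_proj; case: sW. Qed.

Fact sheet_chart_img_open : open img.
Proof.
have -> : img = D `&` ci @^-1` W by [].
rewrite openE => z [Dz Wz]; apply: filterI.
  by apply: open_nbhs_nbhs; split=> //; exact: chart_img_open.
by apply: contci => //; apply: open_nbhs_nbhs; split=> //; case: sW.
Qed.

Fact sheet_chart_mapP y : dom y -> img (c (sec W y)).
Proof. by move=> /sheet_sectionP[Ws _]; split => //=; rewrite cK. Qed.

Fact sheet_chart_invP z : img z -> dom (pr (ci z)).
Proof. by move=> [Dz Wz]; exists (ci z). Qed.

Fact sheet_chart_mapK y : dom y -> pr (ci (c (sec W y))) = y.
Proof. by move=> /sheet_sectionP[_]; rewrite cK. Qed.

Fact sheet_chart_invK z : img z -> c (sec W (pr (ci z))) = z.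
Proof. by move=> [Dz Wz]; rewrite sheet_sectionK// ciK. Qed.

Fact sheet_chart_map_continuous y : dom y -> {for y, continuous (c \o sec W)}.
Proof.
move=> dy; apply: continuous_comp; last exact: contc.
exact: sheet_section_continuous.
Qed.

Fact sheet_chart_inv_continuous z : img z -> {for z, continuous (pr \o ci)}.
Proof.
move=> [Dz _]; apply: continuous_comp; first exact: contci.
exact: orbit_proj_continuous.
Qed.

Definition sheet_chart : chart V orbit_space :=
  @Chart R V orbit_space (c \o sec W) (pr \o ci) dom img
    sheet_chart_dom_open sheet_chart_img_open sheet_chart_mapP sheet_chart_invP
    sheet_chart_mapK sheet_chart_invK
    sheet_chart_map_continuous sheet_chart_inv_continuous.

End sheet_chart.

Definition orbit_atlas : set (chart V orbit_space) :=
  [set k | exists W (sW : sheet W), k = sheet_chart sW].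

Lemma orbit_atlas_cover y : exists2 k, orbit_atlas k & chart_dom k y.
Proof.
rewrite -(orbit_reprK y); have [W sW Wx] := sheet_nbhs (orbit_repr y).
by exists (sheet_chart sW); [exists W, sW|exists (orbit_repr y)].
Qed.

(** Near [z] the translate by [g] stays in [W], where the section inverts the projection. So every
    change of charts is locally an element of [G]. *)
Lemma sheet_transition W z x : sheet W -> D z -> W x -> pr (ci z) = pr x ->
  exists2 g, G g & g z = c x /\ \forall w \near z, c (sec W (pr (ci w))) = g w.
Proof.
move=> sW Dz Wx /orbit_projP[g Gg]; rewrite ciK// => gzx.
exists g => //; split => //.
have nD : \forall w \near z, D w.
  by apply: open_nbhs_nbhs; split=> //; exact: chart_img_open.
have nW : \forall w \near z, W (ci (g w)).
  have h : {for z, continuous (ci \o g)}.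
    apply: continuous_comp; first exact: contG.
    by apply: contci; exact: (pd_stable pdG).
  apply: (h W); rewrite /= gzx cK; apply: open_nbhs_nbhs; split=> //.
  by case: sW.
near=> w.
have Dw : D w by near: w.
rewrite -(orbit_proj_act Gg Dw) sheet_sectionK// ?ciK//; last by near: w.
exact: (pd_stable pdG).
Unshelve. all: by end_near. Qed.

Lemma differentiable_sheet W z : sheet W -> D z -> (pr @` W) (pr (ci z)) ->
  differentiable (c \o sec W \o (pr \o ci)) z.
Proof.
move=> sW Dz [x Wx /esym xz].
have [g Gg [_ gn]] := sheet_transition sW Dz Wx xz.
apply: (near_eq_differentiable (f := g)); last exact: (pd_diff pdG).
by near=> w; rewrite -(near gn).
Unshelve. all: by end_near. Qed.

Lemma orbit_atlas_compatible k1 k2 : orbit_atlas k1 -> orbit_atlas k2 ->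
  forall y, chart_dom k1 y -> chart_dom k2 y ->
    differentiable (k2 \o chart_inv k1) (k1 y).
Proof.
move=> [W1 [sW1 ->]] [W2 [sW2 ->]] y /= d1 d2.
apply: differentiable_sheet => //.
by rewrite /= cK; have [_ ->] := sheet_sectionP d1.
Qed.

Definition translate (W : set T) (g : V -> V) : set T :=
  [set x | exists2 w, W w & c x = g (c w)].

Lemma translateE W g h : G g -> G h -> cancel g h ->
  translate W g = (ci \o h \o c) @^-1` W.
Proof.
move=> Gg Gh gK.
(* [h] has a left inverse too, so it is injective and [g] inverts it on both sides. *)
have hK z : g (h z) = z.
  have [k _ kK] := pd_inv pdG Gh.
  by apply: (can_inj kK); rewrite gK.
apply/seteqP; split=> [x [w Ww /= ->]|x /= Wx]; first by rewrite gK cK.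
by exists (ci (h (c x))) => //; rewrite ciK ?hK//; exact: (pd_stable pdG).
Qed.

Lemma orbit_preimageE W :
  pr @^-1` (pr @` W) = \bigcup_(A in translate W @` G) A.
Proof.
apply/seteqP; split=> [x [w Ww /orbit_projP[g Gg gwx]]|x [_ [g Gg <-] [w Ww xw]]].
  by exists (translate W g); [exists g|exists w].
by exists w => //; apply/orbit_projP; exists g.
Qed.

Lemma open_translate W g : open W -> G g -> open (translate W g).
Proof.
move=> oW Gg; have [h Gh gK] := pd_inv pdG Gg.
rewrite (translateE W Gg Gh gK); apply: open_comp => // x _.
exact: contact.
Qed.

(** This makes the sheets disjoint. The points of [W] that [g] and [h] send to [x] share an orbit,
    so they coincide, and [pd_disc] identifies [g] with [h]. *)
Lemma translate_free W g h x : sheet W -> G g -> G h ->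
  translate W g x -> translate W h x -> g = h.
Proof.
move=> sW Gg Gh [u Wu xu] [v Wv xv].
have [A [B [xA xB AB]]] := pd_disc pdG (imgc u) (imgc x).
have uv : u = v.
  have prE k w : G k -> c x = k (c w) -> pr w = pr x.
    by move=> Gk e; apply/orbit_projP; exists k.
  case: sW => _; apply; try exact: mem_set.
  by rewrite (prE g u)// (prE h v).
apply: (AB g h Gg Gh (c u) (c u)); rewrite -?xu ?[in h _]uv -?xv//.
- exact: nbhs_singleton xA.
- exact: nbhs_singleton xA.
- exact: nbhs_singleton xB.
- exact: nbhs_singleton xB.
Qed.

Lemma orbit_proj_holomorphic (U : set T) :
  holomorphic_on [set c] orbit_atlas U pr.
Proof.
move=> x _; split; first exact: orbit_proj_continuous.
move=> _ _ -> [W [sW ->]] _ /= [w Ww wx].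
apply: differentiable_sheet => //.
by exists w => //; rewrite cK.
Qed.

(** Supplies the discs for the Kobayashi pseudodistance of the quotient. *)
Lemma orbit_disc_holomorphic (U : set (C R)) (f : C R -> V) :
  (forall z, U z -> D (f z)) -> (forall z, differentiable f z) ->
  holomorphic_on (std_atlas (C R)) orbit_atlas U (pr \o ci \o f).
Proof.
move=> fD df z Uz.
have cf : {for z, continuous f} by exact: differentiable_continuous.
split.
  apply: continuous_comp => //; apply: continuous_comp; first exact: contci (fD _ Uz).
  exact: orbit_proj_continuous.
move=> _ _ -> [W [sW ->]] _ dW; rewrite /=.
apply: (@differentiable_comp _ _ _ _ f (c \o sec W \o (pr \o ci))) => //.
by apply: differentiable_sheet => //; exact: fD.
Qed.

Lemma chart_inv_comp_map z (g : V -> V) : G g -> D z ->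
  \forall w \near z, c (ci (g w)) = g w.
Proof.
move=> Gg Dz; have nD : \forall w \near z, D w.
  by apply: open_nbhs_nbhs; split=> //; exact: chart_img_open.
near=> w; rewrite ciK//; apply: (pd_stable pdG) => //.
by near: w.
Unshelve. all: by end_near. Qed.

(** Read in the chart [c], both the map and its inverse are the identity near each point. *)
Lemma chart_biholomorphic :
  biholomorphic_on [set c] (std_atlas V) setT D c.
Proof.
exists ci; split.
- by move=> x _; split; [exact: imgc|exact: cK].
- by move=> z Dz; split => //; exact: ciK.
- move=> x _; split; first exact: contc.
  move=> _ _ -> -> _ _ /=.
  apply: (near_eq_differentiable (f := id)) => //.
  near=> w; rewrite /= -[w in LHS](near (chart_inv_comp_map (pd_id pdG) (imgc x)) w)//.
- move=> z Dz; split; first exact: contci.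
  move=> _ _ -> -> _ _ /=.
  apply: (near_eq_differentiable (f := id)) => //.
  near=> w; rewrite /= -[w in LHS](near (chart_inv_comp_map (pd_id pdG) Dz) w)//.
Unshelve. all: by end_near. Qed.

Lemma chart_compatible k1 k2 : [set c] k1 -> [set c] k2 ->
  forall x, chart_dom k1 x -> chart_dom k2 x ->
    differentiable (k2 \o chart_inv k1) (k1 x).
Proof.
move=> -> -> x _ _; apply: (near_eq_differentiable (f := id)) => //.
near=> w; rewrite /= -[w in LHS](near (chart_inv_comp_map (pd_id pdG) (imgc x)) w)//.
Unshelve. all: by end_near. Qed.

Lemma chart_cover (x : T) : exists2 k, [set c] k & chart_dom k x.
Proof. by exists c => //; rewrite domT. Qed.

(** The inverse picks the point of [W] in the orbit and moves it by [g]; in charts it is a change of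
    charts followed by [g]. *)
Lemma translate_biholomorphic W g : sheet W -> G g ->
  biholomorphic_on [set c] orbit_atlas (translate W g) (pr @` W) pr.
Proof.
move=> sW Gg; exists (ci \o g \o (c \o sec W)); split.
- move=> x [w Ww xw]; have wx : pr w = pr x by apply/orbit_projP; exists g.
  split; first by exists w.
  by rewrite /= -wx sheet_sectionK// -xw cK.
- move=> y dy; have [Ws sy] := sheet_sectionP dy.
  have Dg : D (g (c (sec W y))) by apply: (pd_stable pdG) => //; exact: imgc.
  split; first by exists (sec W y) => //=; rewrite ciK.
  by rewrite /= orbit_proj_act// cK.
- exact: orbit_proj_holomorphic.
move=> y dy; split.
  apply: (@continuous_comp _ _ _ (sec W) (ci \o g \o c)); last exact: contact.
  exact: sheet_section_continuous.
move=> _ _ [W1 [sW1 ->]] -> /= d1 _.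
have [W1s sy] := sheet_sectionP d1.
set z := c (sec W1 y); have Dz : D z by exact: imgc.
have dz : (pr @` W) (pr (ci z)) by rewrite cK sy.
apply: (near_eq_differentiable (f := g \o (c \o sec W \o (pr \o ci)))).
  by near=> w; rewrite /= ciK//; apply: (pd_stable pdG) => //; exact: imgc.
apply: differentiable_comp; first exact: differentiable_sheet.
exact: (pd_diff pdG).
Unshelve. all: by end_near. Qed.

End quotient.

(** * The quotient as a complex manifold, and its covering map *)

Section orbit_manifold.
Context (R : realType) (n : nat) (T : topologicalType).
Context (c : chart 'rV[C R]_n T) (G : set ('rV[C R]_n -> 'rV[C R]_n)).
Hypothesis domT : chart_dom c = setT.
Hypothesis pdG : properly_discontinuous (chart_img c) G.
Hypothesis hT : hausdorff_space T.
Hypothesis scT : @second_countable T.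

(** The topology is that of [T], the complex structure that of the image of [c]. *)
Definition chart_manifold : complexManifold R n :=
  @ComplexManifold R n T [set c] (chart_cover domT)
    (chart_compatible domT pdG) hT scT.

Definition orbit_manifold : complexManifold R n :=
  @ComplexManifold R n (orbit_space pdG) (@orbit_atlas _ _ _ _ _ domT pdG)
    (@orbit_atlas_cover _ _ _ _ _ domT pdG)
    (@orbit_atlas_compatible _ _ _ _ _ domT pdG)
    (@orbit_space_hausdorff _ _ _ _ _ domT pdG (@norm_hausdorff _ _))
    (orbit_space_second_countable domT pdG scT).

Definition orbit_map : chart_manifold -> orbit_manifold := orbit_proj pdG.

Lemma orbit_map_covering : holomorphic_covering orbit_map.
Proof.
split.
- exact: orbit_proj_holomorphic.
- by move=> y; exists (orbit_repr y); exact: orbit_reprK.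
- move=> y; have [W sW Wx] := sheet_nbhs domT pdG (orbit_repr y).
  exists (orbit_map @` W); split.
  + by apply: open_orbit_proj; case: sW.
  + by exists (orbit_repr y) => //; exact: orbit_reprK.
  exists (translate c W @` G); split.
  + by move=> _ [g Gg <-]; apply: (open_translate domT pdG) => //; case: sW.
  + move=> _ _ [g Gg <-] [h Gh <-] [x [xg xh]].
    by rewrite (translate_free domT sW Gg Gh xg xh).
  + exact: orbit_preimageE.
  + by move=> _ [g Gg <-]; exact: translate_biholomorphic.
Qed.

End orbit_manifold.

(** * The half-space as a simply connected manifold *)

Section complex_line.
Context (R : realType).
Implicit Types (x y r : R) (z w : C R).

Definition toC (x : R) : C R := real_complex R x.
Definition reC (z : C R) : R := complex.Re z.
Definition imC (z : C R) : R := complex.Im z.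
Definition iC : C R := Complex 0 1.
(** The norm of [C R] takes its values in [C R]; this is the same number as an element of [R]. *)
Definition normR (z : C R) : R := reC `|z|.

Lemma toCD : {morph toC : x y / x + y}.
Proof. exact: (rmorphD (real_complex R)). Qed.
Lemma toCB : {morph toC : x y / x - y}.
Proof. exact: (rmorphB (real_complex R)). Qed.
Lemma toCM : {morph toC : x y / x * y}.
Proof. exact: (rmorphM (real_complex R)). Qed.
Lemma toCV : {morph toC : x / x^-1}.
Proof. exact: (fmorphV (real_complex R)). Qed.
Lemma toC0 : toC 0 = 0. Proof. by []. Qed.
Lemma toC1 : toC 1 = 1. Proof. by []. Qed.

Lemma reCK x : reC (toC x) = x. Proof. by []. Qed.
Lemma imC_toC x : imC (toC x) = 0. Proof. by []. Qed.
Lemma toC_inj : injective toC. Proof. by move=> x y []. Qed.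

Lemma reCD z w : reC (z + w) = reC z + reC w.
Proof. by case: z w => [a b] [c d]. Qed.
Lemma imCD z w : imC (z + w) = imC z + imC w.
Proof. by case: z w => [a b] [c d]. Qed.
Lemma reCN z : reC (- z) = - reC z. Proof. by case: z. Qed.
Lemma imCN z : imC (- z) = - imC z. Proof. by case: z. Qed.
Lemma reCM z w : reC (z * w) = reC z * reC w - imC z * imC w.
Proof. by case: z w => [a b] [c d]. Qed.
Lemma imCM z w : imC (z * w) = reC z * imC w + imC z * reC w.
Proof. by case: z w => [a b] [c d]. Qed.

Definition ReImE := (reCD, imCD, reCN, imCN, reCM, imCM, reCK, imC_toC).

Lemma complex_ext z w : reC z = reC w -> imC z = imC w -> z = w.
Proof. by case: z w => [a b] [c d] /= -> ->. Qed.

Lemma toC_ReIm z : z = toC (reC z) + iC * toC (imC z).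
Proof. by apply: complex_ext; rewrite !ReImE /=; ring. Qed.

Lemma ltCP z w : (z < w) = (imC w == imC z) && (reC z < reC w).
Proof. exact: (ltcE z w). Qed.
Lemma leCP z w : (z <= w) = (imC w == imC z) && (reC z <= reC w).
Proof. exact: (lecE z w). Qed.

Lemma ltC_toC x y : (toC x < toC y) = (x < y). Proof. exact: ltcR. Qed.
Lemma leC_toC x y : (toC x <= toC y) = (x <= y). Proof. exact: lecR. Qed.

Lemma gt0_toC z : 0 < z -> exists2 r, 0 < r & z = toC r.
Proof.
rewrite ltCP => /andP[/eqP iz rz]; exists (reC z) => //.
by apply: complex_ext.
Qed.

Lemma normRE z : `|z| = toC (normR z).
Proof.
have : (0 : C R) <= `|z| by exact: normr_ge0.
by rewrite leCP => /andP[/eqP h _]; apply: complex_ext.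
Qed.

Lemma normR_ge0 z : 0 <= normR z.
Proof. by rewrite -leC_toC -normRE; exact: normr_ge0. Qed.

Lemma norm_toC x : `|toC x| = toC `|x|.
Proof.
have := @normc_def R (toC x); rewrite /= expr0n addr0 sqrtr_sqr; exact.
Qed.

Lemma normR_toC x : normR (toC x) = `|x|.
Proof. by rewrite /normR norm_toC. Qed.

Lemma normRM z w : normR (z * w) = normR z * normR w.
Proof. by apply: toC_inj; rewrite toCM -!normRE normrM. Qed.

Lemma normR_i : normR iC = 1.
Proof.
have := @normc_def R iC; rewrite /= expr0n add0r expr1n sqrtr1 /normR => h.
by rewrite (_ : `|iC| = toC 1).
Qed.

Lemma le_normRD z w : normR (z + w) <= normR z + normR w.
Proof. by rewrite -leC_toC toCD -!normRE ler_normD. Qed.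

Lemma normRN z : normR (- z) = normR z.
Proof. by rewrite /normR normrN. Qed.

Lemma reC_le_normR z : `|reC z| <= normR z.
Proof. by rewrite -leC_toC -normRE; exact: (normc_ge_Re z). Qed.

Lemma imC_le_normR z : `|imC z| <= normR z.
Proof.
(* The imaginary part of [z] is, up to sign, the real part of [i z]. *)
rewrite -[normR z]mul1r -normR_i -normRM; apply: le_trans (reC_le_normR _).
by rewrite ReImE /= mul0r sub0r mul1r normrN.
Qed.

Lemma normR_le z : normR z <= `|reC z| + `|imC z|.
Proof.
rewrite {1}(toC_ReIm z); apply: le_trans (le_normRD _ _) _.
by rewrite normRM normR_i mul1r !normR_toC.
Qed.

Lemma near_normR (z : C R) r : 0 < r -> \forall w \near z, normR (z - w) < r.
Proof.
move=> r0; have r0' : 0 < toC r by rewrite -toC0 ltC_toC.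
have : \forall w \near z, `|z - w| < toC r.
  by apply/nbhs_ballP; exists (toC r) => // w; rewrite -ball_normE.
by apply: filterS => w; rewrite normRE ltC_toC.
Qed.

Lemma cvg_normR (T : Type) (F : set_system T) (f : T -> C R) (z : C R) :
  Filter F -> (forall r, 0 < r -> \forall t \near F, normR (z - f t) < r) ->
  f @ F --> z.
Proof.
move=> FF h; apply/cvgrPdist_lt => e /gt0_toC[r r0 ->].
near=> t; rewrite normRE ltC_toC; near: t; exact: h.
Unshelve. all: by end_near. Qed.

Lemma toC_continuous : continuous toC.
Proof.
move=> x; apply: cvg_normR => r r0; near=> y.
rewrite -toCB normR_toC; near: y.
by apply/nbhs_ballP; exists r => // y; rewrite -ball_normE.
Unshelve. all: by end_near. Qed.

Lemma imC_continuous : continuous imC.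
Proof.
move=> z; apply/(@cvgrPdist_lt _ _ _ (nbhs z)) => r r0; near=> w.
rewrite -imCN -imCD; apply: le_lt_trans (imC_le_normR _) _.
by near: w; exact: near_normR.
Unshelve. all: by end_near. Qed.

Lemma rat_normR_approx z r : 0 < r ->
  exists q : rat * rat, normR (z - (toC (ratr q.1) + iC * toC (ratr q.2))) < r.
Proof.
move=> r0; have r20 : 0 < r / 2 by rewrite divr_gt0.
have approx x : exists q : rat, `|x - ratr q| < r / 2.
  have [q] := @rat_in_itvoo R (x - r / 2) (x + r / 2) ltac:(by lra).
  by rewrite in_itv /= => /andP[h1 h2]; exists q; rewrite ltr_norml; lra.
have [a ha] := approx (reC z); have [b hb] := approx (imC z); exists (a, b).
apply: le_lt_trans (normR_le _) _; rewrite !ReImE /=.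
rewrite !(mul0r, mulr0, mul1r, add0r, addr0, subr0, oppr0).
by move: ha hb; lra.
Qed.

End complex_line.

(** * Topology of the space of row vectors *)

Section row_vectors.
Context (R : realType) (n : nat).
Local Notation V := 'rV[C R]_n.
Implicit Types v w : V.

Lemma rV_ballP v w (r : R) : 0 < r -> ball v (toC r) w <->
  forall j, normR (v ord0 j - w ord0 j) < r.
Proof.
move=> r0; split=> [[_ h] j|h].
  by have := h ord0 j; rewrite -ball_normE /= normRE ltC_toC.
split=> [|i j]; first by rewrite -(toC0 R) ltC_toC.
by rewrite -ball_normE /= normRE ltC_toC ord1.
Qed.

Lemma rV_nbhsP v (A : set V) : nbhs v A <-> exists2 r : R, 0 < r &
  forall w, (forall j, normR (v ord0 j - w ord0 j) < r) -> A w.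
Proof.
split=> [/nbhs_ballP[e /= /gt0_toC[r r0 ->] h]|[r r0 h]].
  by exists r => // w vw; apply: h; apply/rV_ballP.
apply/nbhs_ballP; exists (toC r); first by rewrite /= -(toC0 R) ltC_toC.
by move=> w /rV_ballP vw; apply: h; exact: vw.
Qed.

(** The base consists of the polydiscs with Gaussian rational centres and radii [1 / (k + 1)]. *)
Lemma rV_second_countable : @second_countable V.
Proof.
pose center (q : 'rV[rat * rat]_n) : V :=
  \row_j (toC (ratr (q ord0 j).1) + @iC R * toC (ratr (q ord0 j).2)).
pose B (p : 'rV[rat * rat]_n * nat) : set V :=
  [set w | forall j, normR (center p.1 ord0 j - w ord0 j) < p.2.+1%:R^-1].
exists (range B); first exact: card_le_trans (card_image_le _ _) (countableP _).
split=> [_ [p _ <-]|v A /rV_nbhsP[r r0 h]].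
  rewrite openE => w Bw; apply/rV_nbhsP.
  have [r r0 hr] : exists2 r : R, 0 < r &
      forall j, normR (center p.1 ord0 j - w ord0 j) + r <= p.2.+1%:R^-1.
    (* Finitely many strict inequalities leave a common margin. The default value 0 is below the
       radius, so the margin is positive even when [n = 0]. *)
    pose m := \big[Num.max/0]_j normR (center p.1 ord0 j - w ord0 j).
    have mj j : normR (center p.1 ord0 j - w ord0 j) <= m.
      exact: le_bigmax_cond.
    exists (p.2.+1%:R^-1 - m); last first.
      by move=> j; rewrite addrCA gerDl subr_le0.
    rewrite subr_gt0 /m; apply: bigmax_lt => [|j _]; last exact: Bw.
    by rewrite invr_gt0.
  exists r => // u wu j.
  rewrite (_ : _ - _ = (center p.1 ord0 j - w ord0 j) + (w ord0 j - u ord0 j)).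
    apply: le_lt_trans (le_normRD _ _) _.
    by apply: lt_le_trans (hr j); rewrite ltrD2l.
  by rewrite addrA subrK.
(* A polydisc of radius less than [r / 2] containing [v] lies within [r] of [v]. *)
have [k kr] : exists k : nat, k.+1%:R^-1 < r / 2.
  have [//|k hk] := @ltr_add_invr R 0 (r / 2) _; first by rewrite divr_gt0.
  by exists k; move: hk; rewrite add0r.
have k0 : (0 : R) < k.+1%:R^-1 by rewrite invr_gt0.
have /choice[q hq] := fun j => rat_normR_approx (v ord0 j) k0.
have cv j : normR (center (\row_j q j) ord0 j - v ord0 j) < k.+1%:R^-1.
  by rewrite -normRN opprB !mxE; exact: hq.
exists (B (\row_j q j, k)); first by split=> //; exists (\row_j q j, k).
move=> w Bw; apply: h => j.
rewrite (_ : _ - _ = - (center (\row_j q j) ord0 j - v ord0 j) +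
    (center (\row_j q j) ord0 j - w ord0 j)); last by ring.
apply: le_lt_trans (le_normRD _ _) _; rewrite normRN.
by apply: lt_trans (ltrD (cv j) (Bw j)) _; rewrite [ltRHS]splitr ltrD.
Qed.

End row_vectors.

Section row_vectors_homotopy.
Context (R : realType) (n : nat).
Local Notation V := 'rV[C R]_n.

(** By convexity: paths are segments, and a loop contracts along the segments from [g t] to
    [g 0]. *)
Lemma rV_simply_connected : simply_connected R V.
Proof.
split; first by exists 0.
  move=> v w; exists (fun t => v + toC t *: (w - v)); split.
  - apply: continuous_subspaceT => t; apply: cvgD; first exact: cvg_cst.
    by apply: cvgZ; [exact: toC_continuous|exact: cvg_cst].
  - by rewrite scale0r addr0.
  - by rewrite toC1 scale1r addrC subrK.
move=> g cg g01; exists (fun p => g p.2 + toC p.1 *: (g 0 - g p.2)); split.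
- have cg2 : {within `[0, 1] `*` `[0, 1], continuous (fun p : R * R => g p.2)}.
    apply/subspace_continuousP => -[s t] [/= s01 t01].
    move/subspace_continuousP : cg => /(_ t t01) cg.
    (* A neighbourhood of [t] relative to the interval pulls back along the second projection to one
       of [(s, t)] relative to the square. *)
    move=> A /= /cg; rewrite /within /= => h.
    have {}h := @cvg_snd _ _ (nbhs s) (nbhs t) (nbhs_filter s) _ h.
    apply: (@filterS _ (nbhs (s, t)) _ _ _ _ h) => -[a b] /= ab [/= _ b01].
    exact: ab.
  apply/subspace_continuousP => p Ap.
  move/subspace_continuousP : cg2 => /(_ p Ap) cg2.
  have cs : toC q.1 @[q --> within (`[0, 1] `*` `[0, 1]) (nbhs p)] --> toC p.1.
    apply: cvg_within_filter; case: p {Ap cg2} => s t.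
    apply: (@cvg_comp _ _ _ fst (@toC R) (nbhs (s, t)) (nbhs s)) => /=.
      exact: cvg_fst.
    exact: toC_continuous.
  exact: (cvgD cg2 (cvgZ cs (cvgB (cvg_cst (g 0)) cg2))).
- by move=> t _ /=; rewrite scale0r addr0.
- by move=> t _ /=; rewrite toC1 scale1r addrC subrK.
- by move=> s _ /=; rewrite -g01 subrr scaler0 addr0.
Qed.

End row_vectors_homotopy.

Section half_space.
Context (R : realType) (n : nat).
Local Notation V := 'rV[C R]_n.+1.
Implicit Types (h : R -> R) (v : V).

Definition half_space : set V := [set v | 0 < imC (v ord0 ord0)].

Lemma half_space_open : open half_space.
Proof.
apply: (@open_comp _ _ (fun v : V => imC (v ord0 ord0)) [set y | 0 < y]).
  move=> v _; apply: (@continuous_comp _ _ _ (fun v : V => v ord0 ord0)).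
    exact: coord_continuous.
  exact: imC_continuous.
exact: open_gt.
Qed.

(** Applies [h] to the imaginary part of the first coordinate and fixes everything else. A chart has
    only to be a homeomorphism, so [h] may be [expR] or [ln] although the shift is not
    holomorphic. *)
Definition im_shift h v : V :=
  v + (iC R * toC (h (imC (v ord0 ord0)) - imC (v ord0 ord0))) *: delta_mx ord0 ord0.

Lemma imC_im_shift h v : imC (im_shift h v ord0 ord0) = h (imC (v ord0 ord0)).
Proof. by rewrite !mxE !eqxx mulr1 !ReImE /=; ring. Qed.

Lemma im_shiftK h k v : k (h (imC (v ord0 ord0))) = imC (v ord0 ord0) ->
  im_shift k (im_shift h v) = v.
Proof.
move=> hk; rewrite {1}/im_shift imC_im_shift hk {1}/im_shift -addrA -scalerDl.
by rewrite -mulrDr -toCD addrA subrK subrr toC0 mulr0 scale0r addr0.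
Qed.

Lemma im_shift_continuous h v : {for imC (v ord0 ord0), continuous h} ->
  {for v, continuous (im_shift h)}.
Proof.
move=> ch.
have ci : imC (w ord0 ord0) @[w --> v] --> imC (v ord0 ord0).
  apply: (@continuous_comp _ _ _ (fun v : V => v ord0 ord0)).
    exact: coord_continuous.
  exact: imC_continuous.
have chi : h (imC (w ord0 ord0)) @[w --> v] --> h (imC (v ord0 ord0)).
  exact: (@cvg_comp _ _ _ (fun w : V => imC (w ord0 ord0)) h _ _ _ ci ch).
have cd : toC (h (imC (w ord0 ord0)) - imC (w ord0 ord0)) @[w --> v] -->
    toC (h (imC (v ord0 ord0)) - imC (v ord0 ord0)).
  apply: (@cvg_comp _ _ _ (fun w : V => h (imC (w ord0 ord0)) - imC (w ord0 ord0))
    (@toC R) _ _ _ (cvgB chi ci)).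
  exact: toC_continuous.
exact: (cvgD (@cvg_id _ (nbhs v)) (cvgZ (cvgM (cvg_cst (iC R)) cd) (cvg_cst _))).
Qed.

Fact half_space_chart_mapP v : setT v -> half_space (im_shift expR v).
Proof. by move=> _; rewrite /half_space /= imC_im_shift expR_gt0. Qed.

Fact half_space_chart_mapK v : setT v -> im_shift (@ln R) (im_shift expR v) = v.
Proof. by move=> _; apply: im_shiftK; rewrite expRK. Qed.

Fact half_space_chart_invK v : half_space v -> im_shift expR (im_shift (@ln R) v) = v.
Proof. by move=> v0; apply: im_shiftK; rewrite lnK// posrE. Qed.

Fact half_space_chart_map_continuous v :
  setT v -> {for v, continuous (im_shift expR)}.
Proof. by move=> _; apply: im_shift_continuous; exact: continuous_expR. Qed.

Fact half_space_chart_inv_continuous v :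
  half_space v -> {for v, continuous (im_shift (@ln R))}.
Proof. by move=> v0; apply: im_shift_continuous; exact: continuous_ln. Qed.

(* The half-space carries the topology of the whole space, which makes simple
   connectedness a matter of straight-line homotopies. *)
Definition half_space_chart : chart V V :=
  @Chart R V V (im_shift expR) (im_shift (@ln R)) setT half_space openT half_space_open
    half_space_chart_mapP (fun _ _ => I)
    half_space_chart_mapK half_space_chart_invK
    half_space_chart_map_continuous half_space_chart_inv_continuous.

End half_space.

(** * The cubic field *)

(* The triple [c] stands for [c0 + c1 x + c2 x^2] in [Z[x]/(x^3 - 3x - 1)], and
   [cubic_norm c] for its norm. *)
Definition cubic := (int * int * int)%type.

Definition cubic_norm (A : comNzRingType) (a b c : A) : A :=
  a * ((a + 3 * c) ^+ 2 - b * (c + 3 * b)) - b * (c * (a + 3 * c) - b ^+ 2)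
    + c * (c * (c + 3 * b) - b * (a + 3 * c)).

Lemma cubic_norm_intr (A : comNzRingType) (a b c : int) :
  (cubic_norm a b c)%:~R = cubic_norm a%:~R b%:~R c%:~R :> A.
Proof.
by rewrite /cubic_norm; ring.
Qed.

(** Modulo 2 the cubic becomes [X^3 + X + 1], which is irreducible: the residue ring is the field
    with eight elements, whose norm vanishes only at 0. *)
Lemma cubic_norm_F2 (a b c : 'F_2) :
  cubic_norm a b c = 0 -> [/\ a = 0, b = 0 & c = 0].
Proof.
have F2 (x : 'F_2) : x = 0 \/ x = 1.
  by case: x => -[|[|//]] i; [left|right]; apply: val_inj.
suff : (cubic_norm a b c == 0) ==> [&& a == 0, b == 0 & c == 0].
  by move=> /implyP h /eqP/h/and3P[/eqP -> /eqP -> /eqP ->].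
by case: (F2 a) (F2 b) (F2 c) => -> [] -> [] ->; vm_compute.
Qed.

Lemma cubic_norm_even (a b c : int) : cubic_norm a b c = 0 ->
  exists a' b' c', [/\ a = 2 * a', b = 2 * b' & c = 2 * c'].
Proof.
move=> N0; have even (x : int) : x%:~R = 0 :> 'F_2 -> exists y, x = 2 * y.
  have [y [xy|xy]] : exists y, x = 2 * y \/ x = 2 * y + 1.
    by exists (x %/ 2)%Z; lia.
  - by exists y.
  - have two : intr 2 = 0 :> 'F_2 by exact: val_inj.
    by rewrite xy intrD intrM two mul0r add0r => /eqP; rewrite oner_eq0.
have [] := @cubic_norm_F2 a%:~R b%:~R c%:~R.
  by rewrite -cubic_norm_intr N0.
by move=> /even[a' ->] /even[b' ->] /even[c' ->]; exists a', b', c'.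
Qed.

(** Infinite descent: a triple of norm 0 is divisible by 2, again and again. *)
Lemma cubic_norm_eq0 (a b c : int) :
  cubic_norm a b c = 0 -> [/\ a = 0, b = 0 & c = 0].
Proof.
have [m] := ubnP (absz a + absz b + absz c).
elim: m a b c => // m IH a b c abc N0.
have [a' [b' [c' [ea eb ec]]]] := cubic_norm_even N0.
have [z|nz] := boolP [&& a == 0, b == 0 & c == 0].
  by move/and3P : z => [/eqP -> /eqP -> /eqP ->].
have [] := IH a' b' c'; [by lia| |by move=> a0 b0 c0; lia].
(* The norm is homogeneous of degree 3, so halving the triple divides it by 8. *)
apply/eqP; rewrite -(mulrI_eq0 _ (@mulfI _ (8 : int) isT)); apply/eqP.
by rewrite -[RHS]N0 ea eb ec /cubic_norm; ring.
Qed.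

(** A subgroup of the reals is dense or cyclic, and a common generator would give an integer
    relation between [p] and [q]. *)
Lemma subgroup_dense (R : realType) (p q : R) : 0 < p ->
  (forall m n : int, m%:~R * p + n%:~R * q = 0 -> m = 0 /\ n = 0) ->
  forall y e : R, 0 < e -> exists m n : int, `|m%:~R * p + n%:~R * q - y| < e.
Proof.
move=> p0 indep.
pose S := [set s : R | exists m n : int, s = m%:~R * p + n%:~R * q].
have SD x s (k : int) : S x -> S s -> S (x - k%:~R * s).
  move=> [m [n ->]] [m' [n' ->]]; exists (m - k * m'), (n - k * n').
  by rewrite !rmorphB !rmorphM /=; ring.
have Sp : S p by exists 1, 0; rewrite mul1r mul0r addr0.
have Sq : S q by exists 0, 1; rewrite mul1r mul0r add0r.
have fl (x s : R) : 0 < s -> 0 <= x - (Num.floor (x / s))%:~R * s < s.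
  move=> s0; have := floor_itv (x / s) => /andP[h1 h2].
  rewrite ler_pdivlMr// in h1; rewrite ltr_pdivrMr// in h2.
  rewrite rmorphD /= mulrDl mul1r in h2.
  by apply/andP; split; lra.
(* The multiples of a positive element of [S] below [e] come within [e] of any [y]. *)
suff small e : 0 < e -> exists2 s, S s & 0 < s < e.
  move=> y e /small[s [m [n sE]] /andP[s0 se]].
  exists (Num.floor (y / s) * m), (Num.floor (y / s) * n).
  have /andP[h1 h2] := fl y s s0; move: h1 h2.
  rewrite !rmorphM /= -!mulrA -mulrDr -sE => h1 h2.
  by rewrite ltr_norml; apply/andP; split; lra.
move=> e0; apply: contrapT => nex.
have lbS s : S s -> 0 < s -> e <= s.
  move=> Ss s0; rewrite leNgt; apply/negP => se.
  by apply: nex; exists s => //; rewrite s0.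
pose P := [set s | S s /\ 0 < s].
have infP : has_inf P by split; [exists p|exists e => s [Ss s0]; exact: lbS].
have d0 : 0 < inf P.
  apply: (lt_le_trans e0); apply: lb_le_inf; first by exists p.
  by move=> s [Ss s0]; exact: lbS.
(* [s] is less than twice the infimum. A nonzero remainder [r] modulo [s] would put both [r] and
   [s - r] in [P], forcing [s] to be at least twice the infimum; so [s] generates [S]. *)
have [s [Ss s0] sd] := inf_adherent d0 infP.
have leP x : S x -> 0 < x -> inf P <= x.
  by move=> Sx x0; apply: ge_inf => //; exists e => z [Sz z0]; exact: lbS.
have mult x : S x -> x = (Num.floor (x / s))%:~R * s.
  move=> Sx; have /andP[h1 h2] := fl x s s0.
  have Sr := SD _ _ (Num.floor (x / s)) Sx Ss.
  set r := x - _ in h1 h2 Sr; have [r0|rn0] := eqVneq r 0.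
    by apply/eqP; rewrite -subr_eq0 -/r r0.
  have rp : 0 < r by rewrite lt_def rn0.
  have Sr' := SD _ _ 1 Ss Sr; rewrite mul1r in Sr'.
  have h3 := leP _ Sr rp; have h4 : inf P <= s - r by apply: leP => //; lra.
  by lra.
have := mult _ Sp; have := mult _ Sq.
set k := Num.floor _; set l := Num.floor _ => qk pl.
have [] := indep (- k) l; first by rewrite pl qk rmorphN /=; ring.
by move=> _ l0; move: p0; rewrite pl l0 mul0r ltxx.
Qed.

Definition cubic_eval (A : comNzRingType) (c : cubic) (x : A) : A :=
  c.1.1%:~R + c.1.2%:~R * x + c.2%:~R * x ^+ 2.

Section cubic_eval.
Context (R : realFieldType).
Implicit Types (c : cubic) (x : R).

Lemma cubic_evalD c d x : cubic_eval (c + d) x = cubic_eval c x + cubic_eval d x.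
Proof. by case: c d => [[? ?] ?] [[? ?] ?]; rewrite /cubic_eval /= !rmorphD /=; ring. Qed.

Lemma cubic_evalN c x : cubic_eval (- c) x = - cubic_eval c x.
Proof. by case: c => [[? ?] ?]; rewrite /cubic_eval /= !rmorphN /=; ring. Qed.

Lemma cubic_evalB c d x : cubic_eval (c - d) x = cubic_eval c x - cubic_eval d x.
Proof. by rewrite cubic_evalD cubic_evalN. Qed.

(* [x] and [x^2 - 2] are units of [Z[x]/(x^3 - 3x - 1)], with inverses
   [x^2 - 3] and [x^2 - x - 1]. *)
Definition cubic_unit (m n : int) (x : R) : R := x ^ m * (x ^+ 2 - 2) ^ n.

Definition cubic_root x := x ^+ 3 = 3 * x + 1.

Lemma cubic_root_inv x : cubic_root x -> x * (x ^+ 2 - 3) = 1.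
Proof. by rewrite /cubic_root => x3; rewrite mulrBr -exprS x3; ring. Qed.

Lemma cubic_root_inv2 x : cubic_root x -> (x ^+ 2 - 2) * (x ^+ 2 - x - 1) = 1.
Proof.
rewrite /cubic_root => x3.
have -> : (x ^+ 2 - 2) * (x ^+ 2 - x - 1) = x * x ^+ 3 - x ^+ 3 - 3 * x ^+ 2 + 2 * x + 2.
  by ring.
by rewrite x3; ring.
Qed.

Lemma cubic_root_neq0 x : cubic_root x -> x != 0.
Proof.
by move=> /cubic_root_inv h; apply/eqP => x0; move/eqP: h; rewrite x0 mul0r eq_sym oner_eq0.
Qed.

Lemma cubic_root_neq2 x : cubic_root x -> x ^+ 2 - 2 != 0.
Proof.
by move=> /cubic_root_inv2 h; apply/eqP => x0; move/eqP: h; rewrite x0 mul0r eq_sym oner_eq0.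
Qed.

Lemma cubic_unit00 x : cubic_unit 0 0 x = 1.
Proof. by rewrite /cubic_unit !expr0z mulr1. Qed.

Lemma cubic_unitD m n m' n' x : cubic_root x ->
  cubic_unit (m + m') (n + n') x = cubic_unit m n x * cubic_unit m' n' x.
Proof.
move=> rx; have [x0 x2] := (cubic_root_neq0 rx, cubic_root_neq2 rx).
by rewrite /cubic_unit !expfzDr//; ring.
Qed.

(** Multiplication by [u] preserves [Z[x]]; one triple [d] serves all roots at once, so that the
    product is formed simultaneously at the three places. *)
Definition cubic_multiplier (u : R -> R) : Prop :=
  forall c, exists d, forall x, cubic_root x -> cubic_eval d x = u x * cubic_eval c x.

Lemma cubic_multiplierM u v : cubic_multiplier u -> cubic_multiplier v ->
  cubic_multiplier (fun x => u x * v x).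
Proof.
move=> hu hv c; have [d hd] := hv c; have [e he] := hu d.
by exists e => x rx; rewrite he// hd// mulrA.
Qed.

Lemma cubic_multiplierX u n : cubic_multiplier u ->
  cubic_multiplier (fun x => u x ^+ n).
Proof.
move=> hu; elim: n => [c|n IH c]; first by exists c => x _; rewrite mul1r.
have [d hd] := cubic_multiplierM hu IH c.
by exists d => x rx; rewrite hd// exprS.
Qed.

(** Here and in the next three lemmas the triple is the product by [x], [x^2 - 3], [x^2 - 2] and
    [x^2 - x - 1] respectively, reduced by [x^3 = 3x + 1]. *)
Lemma cubic_multiplier_root : cubic_multiplier id.
Proof.
move=> [[a b] c]; exists (c, a + 3 * c, b) => x x3.
rewrite /cubic_eval [RHS](_ : _ = a%:~R * x + b%:~R * x ^+ 2 + c%:~R * x ^+ 3)/=.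
  by rewrite x3; ring.
by ring.
Qed.

Lemma cubic_multiplier_rootV : cubic_multiplier (fun x => x^-1).
Proof.
move=> [[a b] c]; exists (b - 3 * a, c, a) => x x3.
apply: (mulfI (cubic_root_neq0 x3)); rewrite mulVKf ?cubic_root_neq0// /cubic_eval.
rewrite [LHS](_ : _ = (b - 3 * a)%:~R * x + c%:~R * x ^+ 2 + a%:~R * x ^+ 3)/=.
  by rewrite x3; ring.
by ring.
Qed.

Lemma cubic_multiplier_root2 : cubic_multiplier (fun x => x ^+ 2 - 2).
Proof.
move=> [[a b] c]; exists (b - 2 * a, b + c, a + c) => x x3.
rewrite /cubic_eval [RHS](_ : _ = (b%:~R + c%:~R * x) * x ^+ 3 + a%:~R * x ^+ 2
  - 2 * (a%:~R + b%:~R * x + c%:~R * x ^+ 2))/=; last by ring.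
by rewrite x3; ring.
Qed.

Lemma cubic_multiplier_root2V : cubic_multiplier (fun x => (x ^+ 2 - 2)^-1).
Proof.
move=> [[a b] c]; exists (b - c - a, 2 * b - a - 2 * c, a + 2 * c - b) => x x3.
apply: (mulfI (cubic_root_neq2 x3)); rewrite mulVKf ?cubic_root_neq2// /cubic_eval /=.
rewrite [LHS](_ : _ = ((2 * b - a - 2 * c)%:~R + (a + 2 * c - b)%:~R * x) * x ^+ 3
  + (b - c - a)%:~R * x ^+ 2 - 2 * ((b - c - a)%:~R + (2 * b - a - 2 * c)%:~R * x
  + (a + 2 * c - b)%:~R * x ^+ 2)); last by ring.
by rewrite x3; ring.
Qed.

Lemma cubic_multiplier_unit m n : cubic_multiplier (cubic_unit m n).
Proof.
have powz u (k : int) : cubic_multiplier u -> cubic_multiplier (fun x => (u x)^-1) ->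
    cubic_multiplier (fun x => u x ^ k).
  move=> hu hV; case: k => k; first exact: cubic_multiplierX.
  move=> c; have [d hd] := cubic_multiplierX k.+1 hV c.
  by exists d => x rx; rewrite hd// NegzE -exprnN -exprVn.
apply: cubic_multiplierM; apply: powz.
- exact: cubic_multiplier_root.
- exact: cubic_multiplier_rootV.
- exact: cubic_multiplier_root2.
- exact: cubic_multiplier_root2V.
Qed.

(** The conjugates of a root [x]: the Galois group is cyclic, generated by [conj1], and [conj2] is
    the reduced form of [conj1] applied twice. *)
Definition conj1 x : R := 2 - x ^+ 2.
Definition conj2 x : R := x ^+ 2 - x - 2.

Lemma cubic_root_conj1 x : cubic_root x -> cubic_root (conj1 x).
Proof.
rewrite /cubic_root /conj1 => x3; apply/eqP; rewrite -subr_eq0.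
rewrite (_ : _ - _ = - (x ^+ 3 - 3 * x + 1) * (x ^+ 3 - (3 * x + 1))).
  by rewrite x3 subrr mulr0.
by ring.
Qed.

Lemma cubic_root_conj2 x : cubic_root x -> cubic_root (conj2 x).
Proof.
move=> x3; rewrite (_ : conj2 x = conj1 (conj1 x)).
  by apply/cubic_root_conj1/cubic_root_conj1.
have -> : conj1 (conj1 x) = 4 * x ^+ 2 - 2 - x * x ^+ 3 by rewrite /conj1; ring.
by rewrite x3 /conj2; ring.
Qed.

(** [cubic_norm] is the determinant of the multiplication by an element of [Z[x]], hence the product
    of its conjugates. *)
Lemma cubic_norm_conj c x : cubic_root x ->
  cubic_eval c x * cubic_eval c (conj1 x) * cubic_eval c (conj2 x) =
    (cubic_norm c.1.1 c.1.2 c.2)%:~R.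
Proof.
case: c => [[a b] c] x3; rewrite cubic_norm_intr /=.
have -> : cubic_eval (a, b, c) (conj1 x) =
    a%:~R + 2 * b%:~R + 4 * c%:~R + c%:~R * x - (b%:~R + c%:~R) * x ^+ 2.
  rewrite [LHS](_ : _ = a%:~R + b%:~R * (2 - x ^+ 2)
    + c%:~R * (4 - 4 * x ^+ 2 + x * x ^+ 3)); last by rewrite /cubic_eval /conj1 /=; ring.
  by rewrite x3; ring.
have -> : cubic_eval (a, b, c) (conj2 x) =
    a%:~R - 2 * b%:~R + 2 * c%:~R + b%:~R * x ^+ 2 - (b%:~R + c%:~R) * x.
  rewrite [LHS](_ : _ = a%:~R + b%:~R * (x ^+ 2 - x - 2)
    + c%:~R * (x * x ^+ 3 - 2 * x ^+ 3 - 3 * x ^+ 2 + 4 * x + 4)); last first.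
    by rewrite /cubic_eval /conj2 /=; ring.
  by rewrite x3; ring.
rewrite /cubic_eval /=; move: a%:~R b%:~R c%:~R => {}a {}b {}c.
(* The long factor is the quotient of the difference of the two sides by [x^3 - 3x - 1]. *)
apply/eqP; rewrite -subr_eq0 (_ : _ - _ = (x ^+ 3 - (3 * x + 1)) *
  (- x ^+ 3 * b ^+ 2 * c - x ^+ 3 * b * c ^+ 2 - x ^+ 2 * b ^+ 3
   + 3 * x ^+ 2 * b * c ^+ 2 + x ^+ 2 * c ^+ 3 - x * a * b ^+ 2 - x * a * b * c
   - x * a * c ^+ 2 + x * b ^+ 3 + 4 * x * b ^+ 2 * c + x * b * c ^+ 2
   - 3 * x * c ^+ 3 + a * b ^+ 2 + a * b * c + a * c ^+ 2 + b ^+ 3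
   - 3 * b * c ^+ 2 + c ^+ 3)); last by rewrite /cubic_norm; ring.
by rewrite x3 subrr mul0r.
Qed.

(** Discreteness of the lattice: the norm is an integer of absolute value below 1, hence 0. *)
Lemma cubic_norm_small c x : cubic_root x -> `|cubic_eval c x| < 1 ->
  `|cubic_eval c (conj1 x)| < 1 -> `|cubic_eval c (conj2 x)| < 1 -> c = 0.
Proof.
move=> rx h0 h1 h2.
have : `|(cubic_norm c.1.1 c.1.2 c.2)%:~R : R| < 1.
  rewrite -(cubic_norm_conj c rx) !normrM -[ltRHS]mulr1 ltr_pM// ?mulr_ge0//.
  by rewrite -[ltRHS]mulr1 ltr_pM.
rewrite -intr_norm -[ltRHS]/(1%:~R) ltr_int => N1.
have /cubic_norm_eq0 : cubic_norm c.1.1 c.1.2 c.2 = 0 by lia.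
by case: c {h0 h1 h2 N1} => [[a b] c] /= [-> -> ->].
Qed.

Lemma cubic_eval_eq0 c x : cubic_root x -> cubic_eval c x = 0 -> c = 0.
Proof.
move=> rx c0; have := cubic_norm_conj c rx; rewrite c0 !mul0r => /esym/eqP.
rewrite intr_eq0 => /eqP/cubic_norm_eq0.
by case: c {c0} => [[a b] c] /= [-> -> ->].
Qed.

End cubic_eval.

(** * Density of the units and of the lattice at the first real place *)

Section cubic_dense.
Context (R : realType).

Lemma cubic_root_exists : exists2 x : R, cubic_root x & 1 < x < 2.
Proof.
pose p : {poly R} := 'X^3 - 3%:P * 'X - 1.
have pE x : p.[x] = x ^+ 3 - 3 * x - 1 by rewrite /p !hornerE.
have [||x /andP[x1 x2] /rootP] := @poly_ivt R p 1 2; first by lra.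
  by rewrite !pE; apply/andP; split; lra.
rewrite pE => px; have rx : cubic_root x by rewrite /cubic_root; lra.
exists x => //; rewrite !lt_def x1 x2 !andbT; apply/andP; split; apply/eqP => xE.
  by move: px; rewrite xE; lra.
by move: px; rewrite -xE; lra.
Qed.

Lemma cubic_unit_ln m n (x : R) : x != 0 -> x ^+ 2 - 2 != 0 ->
  `|cubic_unit m n x| = expR (m%:~R * ln `|x| + n%:~R * ln `|x ^+ 2 - 2|).
Proof.
have expz (y : R) (k : int) : y != 0 -> `|y ^ k| = expR (k%:~R * ln `|y|).
  move=> y0; have yE : expR (ln `|y|) = `|y| by rewrite lnK// posrE normr_gt0.
  case: k => k; first by rewrite expRM_natl yE normrX.
  by rewrite NegzE -exprnN rmorphN mulNr expRN expRM_natl yE normfV normrX.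
by move=> x0 x20; rewrite expRD -!expz// normrM.
Qed.

Context (x : R).
Hypothesis rx : cubic_root x.
Hypothesis x12 : 1 < x < 2.

Let x3 : 3 < x ^+ 2.
Proof.
have /andP[x1 _] := x12; have := cubic_root_inv rx => h.
have : 0 < x ^+ 2 - 3 by rewrite -(pmulr_rgt0 _ (lt_trans ltr01 x1)) h.
by rewrite subr_gt0.
Qed.

Lemma cubic_unit_gt0 m n : 0 < cubic_unit m n x.
Proof.
by have /andP[x1 _] := x12; rewrite mulr_gt0// exprz_gt0//; move: x3; lra.
Qed.

(** A unit equal to 1 at [x] is 1 in [Z[x]], hence also at the conjugate [y]. Logarithms at both
    places give two linear equations in [m] and [n], with nonzero determinant by the signs of its
    entries. *)
Lemma cubic_unit_indep m n : cubic_unit m n x = 1 -> m = 0 /\ n = 0.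
Proof.
move=> u1; have [d hd] := cubic_multiplier_unit R m n (1, 0, 0).
have e1 y : cubic_eval (1, 0, 0) y = 1 :> R.
  by rewrite /cubic_eval /= !mul0r !addr0.
have d1 : d = (1, 0, 0).
  apply/eqP; rewrite -subr_eq0; apply/eqP; apply: (cubic_eval_eq0 rx).
  by rewrite cubic_evalB hd// u1 e1 mulr1 subrr.
set y := conj1 x; have ry : cubic_root y := cubic_root_conj1 rx.
have v1 : cubic_unit m n y = 1 by have := hd _ ry; rewrite d1 e1 mulr1.
have /andP[x1 x2] := x12.
(* These bounds give the signs: at [x] both units exceed 1, while at [y] the first exceeds 1 in
   absolute value and the second stays below 1. *)
have y1 : y < - 1 by rewrite /y /conj1; move: x3; lra.
have y2 : 1 < y ^+ 2 by nra.
have y3 : y ^+ 2 < 3 by have := cubic_root_inv ry; nra.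
have A := cubic_unit_ln m n (cubic_root_neq0 rx) (cubic_root_neq2 rx).
have B := cubic_unit_ln m n (cubic_root_neq0 ry) (cubic_root_neq2 ry).
rewrite u1 v1 normr1 in A B.
have {}A := expR_inj (etrans (esym A) (esym (@expR0 R))).
have {}B := expR_inj (etrans (esym B) (esym (@expR0 R))).
have A1 : 0 < ln `|x| by rewrite ln_gt0// ltr_normr x1.
have A2 : 0 < ln `|x ^+ 2 - 2| by rewrite ln_gt0// ltr_normr; apply/orP; left; move: x3; lra.
have B1 : 0 < ln `|y| by rewrite ln_gt0// ltr_normr; apply/orP; right; lra.
have B2 : ln `|y ^+ 2 - 2| < 0.
  rewrite ln_lt0// normr_gt0 (cubic_root_neq2 ry)/= ltr_norml.
  by apply/andP; split; lra.
move: A B A1 A2 B1 B2; set a1 := ln _; set a2 := ln _; set b1 := ln _; set b2 := ln _.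
move=> A B a10 a20 b10 b20.
have n0 : n%:~R = 0 :> R.
  have p0 : 0 < a2 * b1 - a1 * b2.
    have h : a1 * b2 < 0 by rewrite pmulr_rlt0.
    by rewrite subr_gt0 (lt_trans h (mulr_gt0 a20 b10)).
  apply: (mulIf (lt0r_neq0 p0)); rewrite mul0r.
  rewrite (_ : _ * _ = (m%:~R * a1 + n%:~R * a2) * b1 - (m%:~R * b1 + n%:~R * b2) * a1).
    by rewrite A B !mul0r subrr.
  by ring.
have m0 : m%:~R = 0 :> R.
  by apply: (mulIf (lt0r_neq0 a10)); rewrite mul0r -A n0 mul0r addr0.
by split; apply/eqP; rewrite -(intr_eq0 R) ?m0 ?n0.
Qed.

(** The logarithms of the units form a dense subgroup, and [expR] is continuous at [ln y]. *)
Lemma cubic_unit_dense (y e : R) : 0 < y -> 0 < e ->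
  exists m n, `|cubic_unit m n x - y| < e.
Proof.
move=> y0 e0; have /andP[x1 x2] := x12.
have [x_neq0 x_neq2] := (cubic_root_neq0 rx, cubic_root_neq2 rx).
have := @continuous_expR R (ln y) => /cvgrPdist_lt /(_ e e0) /nbhs_ballP[d /= d0 h].
have indep (m n : int) :
    m%:~R * ln `|x| + n%:~R * ln `|x ^+ 2 - 2| = 0 -> m = 0 /\ n = 0.
  move=> mn; apply: cubic_unit_indep.
  by rewrite -[LHS]gtr0_norm ?cubic_unit_gt0// cubic_unit_ln// mn expR0.
have [] := subgroup_dense _ indep (ln y) d0; first by rewrite ln_gt0// ltr_normr x1.
move=> m [n mn]; exists m, n; rewrite -[cubic_unit _ _ _]gtr0_norm ?cubic_unit_gt0//.
rewrite cubic_unit_ln// distrC -[y in y - _]lnK ?posrE//; apply: h.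
by rewrite -ball_normE /= distrC.
Qed.

(** The elements [m + n x] are already dense, [x] being irrational. *)
Lemma cubic_eval_dense (y e : R) : 0 < e -> exists c, `|cubic_eval c x - y| < e.
Proof.
move=> e0; have indep (m n : int) : m%:~R * 1 + n%:~R * x = 0 -> m = 0 /\ n = 0.
  move=> mn; suff [-> ->] : (m, n, 0) = 0 :> cubic by [].
  by apply: (cubic_eval_eq0 rx); rewrite /cubic_eval /= mul0r addr0 -mn mulr1.
have [m [n mn]] := subgroup_dense ltr01 indep y e0; exists (m, n, 0).
by rewrite /cubic_eval /= mul0r addr0 -[m%:~R]mulr1.
Qed.

End cubic_dense.

(** * The group action *)

Section diagonal_affine.
Context (R : realType) (n : nat).
Local Notation V := 'rV[C R]_n.

Definition diag_affine (a b : 'I_n -> C R) (v : V) : V :=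
  \row_j (a j * v ord0 j + b j).

Lemma diag_affine_differentiable a b (v : V) : differentiable (diag_affine a b) v.
Proof.
have -> : diag_affine a b =
    \sum_(j < n) ((fun v : V => (a j * v ord0 j + b j) *: delta_mx ord0 j)).
  apply/funext => w; rewrite fct_sumE [LHS]row_sum_delta.
  by apply: eq_bigr => j _; rewrite mxE.
apply: differentiable_sum => j; apply: differentiableZl.
apply: differentiableD; last exact: differentiable_cst.
apply: differentiableM; first exact: differentiable_cst.
exact: differentiable_coord.
Qed.

End diagonal_affine.

Section deck_group.
Context (R : realType) (x : R).
Hypothesis rx : cubic_root x.
Hypothesis x12 : 1 < x < 2.
Local Notation V := 'rV[C R]_4.
Implicit Types (m n : int) (c : cubic) (j : 'I_4).

(** The three roots go with the coordinates 0, 1 and 2; [deck_lin] and [deck_tr] treat the last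
    coordinate separately. *)
Definition place j : R :=
  match val j with 0 => x | 1 => conj1 x | _ => conj2 x end.

Lemma cubic_root_place j : cubic_root (place j).
Proof.
rewrite /place; case: (val j) => [//|[|_]]; first exact: cubic_root_conj1.
exact: cubic_root_conj2.
Qed.
Let rp := cubic_root_place.

Definition deck_lin m n j : C R :=
  if j == ord_max then 1 else toC (cubic_unit m n (place j)).

Definition deck_tr m n c j : C R :=
  if j == ord_max then toC m%:~R + iC R * toC n%:~R else toC (cubic_eval c (place j)).

(* Translating the last coordinate by [m + i n] makes the action of the units
   discontinuous, although their values at the first place are dense in the positive reals. *)
Definition deck m n c : V -> V := diag_affine (deck_lin m n) (deck_tr m n c).

Definition deck_group : set (V -> V) := [set g | exists m n c, g = deck m n c].

Lemma deckE m n c (v : V) j :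
  deck m n c v ord0 j = deck_lin m n j * v ord0 j + deck_tr m n c j.
Proof. by rewrite mxE. Qed.

Lemma deck_id : deck 0 0 0 = id.
Proof.
apply/funext => v; apply/rowP => j; rewrite deckE /deck_lin /deck_tr.
case: ifP => _; first by rewrite mul1r mulr0z (toC0 R) mulr0 !addr0.
by rewrite cubic_unit00 (toC1 R) mul1r /cubic_eval /= !mulr0z !mul0r !addr0.
Qed.

(** [d] is the unit times [c']; its values at the places are recorded in order to identify the
    inverse in [deck_inv]. *)
Lemma deck_comp m n c m' n' c' : exists2 d,
  forall j, cubic_eval d (place j) = cubic_unit m n (place j) * cubic_eval c' (place j) &
  deck m n c \o deck m' n' c' = deck (m + m') (n + n') (c + d).
Proof.
have [d hd] := cubic_multiplier_unit R m n c'.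
exists d => [j|]; first exact: hd.
apply/funext => v; apply/rowP => j; rewrite /= !deckE /deck_lin /deck_tr.
case: ifP => _; first by rewrite !mul1r !rmorphD /= !toCD; ring.
by rewrite cubic_unitD// cubic_evalD hd// !(toCD, toCM); ring.
Qed.

Lemma deck_inv m n c : exists2 h, deck_group h & cancel (deck m n c) h.
Proof.
(* [d] is [c] times the inverse unit, so the inverse map translates by [- d]. *)
have [d hd _] := deck_comp (- m) (- n) 0 m n c.
exists (deck (- m) (- n) (- d)); first by exists (- m), (- n), (- d).
move=> v; have [e he] := deck_comp (- m) (- n) (- d) m n c.
move/(congr1 (fun f => f v)) => /= ->; rewrite !addNr.
suff -> : - d + e = 0 by rewrite deck_id.
apply: (cubic_eval_eq0 rx); rewrite cubic_evalD cubic_evalN.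
by have := he ord0; have := hd ord0; rewrite /place /= => -> ->; rewrite addNr.
Qed.

Lemma deck_half_space m n c v : half_space v -> half_space (deck m n c v).
Proof.
rewrite /half_space /= deckE /deck_lin /deck_tr /= !ReImE mul0r addr0 addr0 => v0.
by rewrite mulr_gt0// cubic_unit_gt0.
Qed.

Lemma deck_inj m n c m' n' c' : m = m' -> n = n' ->
  (forall j, j != ord_max ->
    `|cubic_eval c (place j) - cubic_eval c' (place j)| < 1) ->
  deck m n c = deck m' n' c'.
Proof.
move=> -> -> h; suff -> : c = c' by [].
apply/eqP; rewrite -subr_eq0; apply/eqP; apply: (cubic_norm_small rx).
- by rewrite cubic_evalB; exact: (h ord0).
- by rewrite cubic_evalB; exact: (h (@Ordinal 4 1 isT)).
- by rewrite cubic_evalB; exact: (h (@Ordinal 4 2 isT)).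
Qed.

Lemma gaussian_eq m n m' n' (z : C R) :
  normR (z - (toC m%:~R + iC R * toC n%:~R)) < 2^-1 ->
  normR (z - (toC m'%:~R + iC R * toC n'%:~R)) < 2^-1 -> m = m' /\ n = n'.
Proof.
move=> h1 h2.
have close (a b : int) : `|a%:~R - b%:~R : R| < 1 -> a = b.
  by rewrite -rmorphB -intr_norm -[1]/(1%:~R) ltr_int => ?; lia.
have h : normR (toC (m'%:~R - m%:~R) + iC R * toC (n'%:~R - n%:~R)) < 1.
  rewrite (_ : _ + _ = (z - (toC m%:~R + iC R * toC n%:~R)) -
      (z - (toC m'%:~R + iC R * toC n'%:~R))); last by rewrite !toCB; ring.
  apply: le_lt_trans (le_normRD _ _) _; rewrite normRN; lra.
split; apply/esym; apply: close.
  apply: le_lt_trans h; apply: le_trans (reC_le_normR _).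
  by rewrite !ReImE /= !(mul0r, mulr0, subr0, addr0).
apply: le_lt_trans h; apply: le_trans (imC_le_normR _).
by rewrite !ReImE /= !(mul0r, mulr0, mul1r, add0r, addr0).
Qed.

Lemma deck_discontinuous (v w : V) : exists A B : set V,
  [/\ nbhs v A, nbhs w B & forall g h, deck_group g -> deck_group h ->
    forall a b, A a -> A b -> B (g a) -> B (h b) -> g = h].
Proof.
pose near_pt m n := normR (w ord0 ord_max - v ord0 ord_max -
  (toC m%:~R + iC R * toC n%:~R)) < 2^-1.
(* The translation of the last coordinate is close to [w - v] there, and two Gaussian integers
   within 1/2 of the same point are equal. If none is that close, any pair will do. *)
have [[m0 n0] uniq] : exists p : int * int, forall m n, near_pt m n -> (m, n) = p.
  have [[m [n mn]]|nex] := pselect (exists m n, near_pt m n); last first.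
    by exists 0 => m n mn; exfalso; apply: nex; exists m, n.
  by exists (m, n) => m' n' mn'; have [-> ->] := gaussian_eq mn mn'.
pose M := \big[Num.max/0]_j normR (deck_lin m0 n0 j).
have M0 : 0 <= M by exact: bigmax_ge_id.
have Mj j : normR (deck_lin m0 n0 j) <= M by exact: le_bigmax_cond.
(* The bound 1/4 keeps the translation of the last coordinate within [2 r < 1/2] of [w - v]; the
   second bound, with [M] controlling the linear part fixed by [(m0, n0)], keeps the lattice
   translations less than 1 apart at each place. *)
have [r r0 [r1 r2]] : exists2 r : R, 0 < r & r < 4^-1 /\ 2 * r + M * (2 * r) < 1.
  exists (4 * (M + 1) + 1)^-1; first by rewrite invr_gt0; lra.
  split.
    by rewrite ltf_pV2 ?posrE; lra.
  rewrite (_ : _ + _ = (2 * (M + 1)) / (4 * (M + 1) + 1)); last by ring.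
  by rewrite ltr_pdivrMr; lra.
exists [set a | forall j, normR (v ord0 j - a ord0 j) < r].
exists [set a | forall j, normR (w ord0 j - a ord0 j) < r]; split.
- by apply/rV_nbhsP; exists r.
- by apply/rV_nbhsP; exists r.
have pt m n c (a : V) : (forall j, normR (v ord0 j - a ord0 j) < r) ->
    (forall j, normR (w ord0 j - deck m n c a ord0 j) < r) -> (m, n) = (m0, n0).
  move=> va wga; apply: uniq; have := wga ord_max; have := va ord_max.
  rewrite deckE /deck_lin /deck_tr eqxx mul1r => h1 h2; rewrite /near_pt.
  set t := toC _ + _ in h2 *.
  rewrite (_ : _ - t = (w ord0 ord_max - (a ord0 ord_max + t)) -
     (v ord0 ord_max - a ord0 ord_max)); last by ring.
  by apply: le_lt_trans (le_normRD _ _) _; rewrite normRN; lra.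
move=> _ _ [m [n [c ->]]] [m' [n' [c' ->]]] a b va vb wga whb.
have [em en] := pt _ _ _ _ va wga; have [em' en'] := pt _ _ _ _ vb whb.
subst m n m' n'; apply: deck_inj => // j j3.
have := wga j; have := whb j; rewrite !deckE /deck_tr (negbTE j3).
set U := deck_lin _ _ _; set s := cubic_eval c _; set s' := cubic_eval c' _ => h1 h2.
rewrite -normR_toC toCB.
rewrite (_ : _ - _ = (w ord0 j - (U * b ord0 j + toC s')) - (w ord0 j - (U * a ord0 j + toC s))
  + U * ((v ord0 j - a ord0 j) - (v ord0 j - b ord0 j))); last by ring.
apply: le_lt_trans (le_normRD _ _) _.
have k1 := le_normRD (w ord0 j - (U * b ord0 j + toC s')) (- (w ord0 j - (U * a ord0 j + toC s))).
have k2 := le_normRD (v ord0 j - a ord0 j) (- (v ord0 j - b ord0 j)).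
rewrite normRM; rewrite normRN in k1; rewrite normRN in k2.
have k3 : normR U * normR (v ord0 j - a ord0 j - (v ord0 j - b ord0 j)) <= M * (2 * r).
  apply: ler_pM; rewrite ?normR_ge0//; first exact: Mj.
  by have := va j; have := vb j; lra.
lra.
Qed.

Lemma deck_group_pd : properly_discontinuous (@half_space R 3) deck_group.
Proof.
split.
- by exists 0, 0, 0; rewrite deck_id.
- move=> _ _ [m [n [c ->]]] [m' [n' [c' ->]]].
  have [d _ ->] := deck_comp m n c m' n' c'.
  by exists (m + m'), (n + n'), (c + d).
- by move=> _ [m [n [c ->]]]; exact: deck_inv.
- by move=> _ [m [n [c ->]]] z; exact: deck_half_space.
- by move=> _ [m [n [c ->]]] z; exact: diag_affine_differentiable.
- by move=> v w _ _; exact: deck_discontinuous.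
Qed.

(** The lattice translates by reals, so a unit first adjusts the imaginary part, and a lattice
    element then adjusts the real part. *)
Lemma deck_orbit_dense (z w : C R) (e : R) : 0 < imC z -> 0 < imC w -> 0 < e ->
  exists m n c, normR (toC (cubic_unit m n x) * w + toC (cubic_eval c x) - z) < e.
Proof.
move=> z0 w0 e0; have e20 : 0 < e / 2 by rewrite divr_gt0.
(* The error in the unit gets multiplied by [imC w]. *)
have ew0 : 0 < e / 2 / imC w by rewrite divr_gt0.
have [m [n hu]] := cubic_unit_dense rx x12 (divr_gt0 z0 w0) ew0.
have [c hc] := cubic_eval_dense rx (reC z - cubic_unit m n x * reC w) e20.
exists m, n, c; apply: le_lt_trans (normR_le _) _.
rewrite !ReImE /= !mul0r !subr0 !addr0 [e]splitr ltrD//.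
  by rewrite (_ : _ - _ = cubic_eval c x - (reC z - cubic_unit m n x * reC w))//; ring.
move: hu; rewrite ltr_pdivlMr// -{2}(gtr0_norm w0) -normrM mulrBl divfK//.
exact: lt0r_neq0.
Qed.

End deck_group.

(** * Kobayashi distance of the quotient *)

Section poincare_distance.
Context (R : realType).
Implicit Types a b : C R.

Lemma poincare_dist_ge0 a b : unit_disc a -> unit_disc b -> 0 <= poincare_dist a b.
Proof.
rewrite /unit_disc /= => a1 b1.
(* The right-hand side is positive on the disc, so the quotient in [poincare_dist] has modulus below
   1 and the logarithm is taken of a number at least 1. *)
have id2 : `|1 - b^* * a| ^+ 2 - `|a - b| ^+ 2 = (1 - `|a| ^+ 2) * (1 - `|b| ^+ 2).
  by rewrite !normCK !rmorphB !rmorphM rmorph1 /= conjCK; ring.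
have lt : `|a - b| < `|1 - b^* * a|.
  rewrite -(@ltr_pXn2r _ 2)// ?nnegrE// -subr_gt0 id2.
  by rewrite mulr_gt0// subr_gt0 expr_lt1.
have r1 : normR ((a - b) / (1 - b^* * a)) < 1.
  rewrite -ltC_toC -normRE normrM normfV ltr_pdivrMr ?mul1r//.
  by apply: le_lt_trans lt.
have r0 := normR_ge0 ((a - b) / (1 - b^* * a)).
rewrite /poincare_dist -/(reC _) -/(normR _) ln_ge0// ler_pdivlMr; lra.
Qed.

Lemma poincare_dist_radius (r : R) : 0 <= r ->
  poincare_dist 0 (toC r) = ln ((1 + r) / (1 - r)).
Proof.
move=> r0; rewrite /poincare_dist mulr0 subr0 divr1 sub0r normrN -/(reC _) -/(normR _).
by rewrite normR_toC ger0_norm.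
Qed.

(** The radius is the hyperbolic tangent of [e / 2]. *)
Lemma poincare_radius (e : R) : 0 < e ->
  exists r : R, 0 < r < 1 /\ poincare_dist 0 (toC r) = e.
Proof.
move=> e0; have E1 : 1 < expR e by rewrite expR_gt1.
have E2 : 0 < expR e + 1 by lra.
have rE1 : 0 < (expR e - 1) / (expR e + 1) by rewrite divr_gt0// subr_gt0.
exists ((expR e - 1) / (expR e + 1)); split.
  by rewrite rE1 ltr_pdivrMr// mul1r; lra.
rewrite poincare_dist_radius ?ltW// -[RHS]expRK; congr ln; field.
by apply/andP; split; apply/eqP; lra.
Qed.

End poincare_distance.

Section kobayashi.
Context (R : realType).

Lemma kobayashi_ge0 n (Y : complexManifold R n) (p q : Y) : (0 <= kobayashi p q)%E.
Proof.
apply: le_ereal_inf_tmp => _ [k [P [a [b [f [_ _ _ h ->]]]]]].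
rewrite lee_fin; apply: sumr_ge0 => i _; have [ai bi _ _ _] := h i (ltn_ord i).
exact: poincare_dist_ge0.
Qed.

Lemma kobayashi_le_disc n (Y : complexManifold R n) (f : C R -> Y) a b :
  holomorphic_on (std_atlas (C R)) (atlas Y) (@unit_disc R) f ->
  unit_disc a -> unit_disc b -> (kobayashi (f a) (f b) <= (poincare_dist a b)%:E)%E.
Proof.
move=> hf ha hb; apply: ereal_inf_lbound.
exists 1%N, (fun i => if i == 0%N then f a else f b), (fun=> a), (fun=> b), (fun=> f).
by split=> //; [case|rewrite big_ord1].
Qed.

Context (n : nat) (G : set ('rV[C R]_n.+1 -> 'rV[C R]_n.+1)).
Hypothesis pdG : properly_discontinuous (@half_space R n) G.
Hypothesis denseG : forall (v w : 'rV[C R]_n.+1) (e : R), half_space v -> half_space w ->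
  0 < e -> exists2 g, G g & normR (g w ord0 ord0 - v ord0 ord0) < e.

Let domT : chart_dom (half_space_chart R n) = setT. Proof. by []. Qed.

Definition half_space_quotient : complexManifold R n.+1 :=
  orbit_manifold domT pdG (@rV_second_countable R n.+1).

(* If the first coordinates of [v] and [g w] differ by less than [r Im v_1], the disc
   [z |-> v + (z / r) (g w - v)] stays in the half-space, however far apart the other
   coordinates are; it joins [v] to [g w] at Poincare distance [d(0, r)]. *)
Lemma half_space_quotient_kobayashi (p q : half_space_quotient) : kobayashi p q = 0%E.
Proof.
apply/eqP; rewrite eq_le kobayashi_ge0 andbT; apply/lee_addgt0Pr => e e0; rewrite add0e.
have [r [/andP[r0 r1] <-]] := poincare_radius e0.
pose c := half_space_chart R n.
have [v vE] : exists v, v = c (orbit_repr p) by exists (c (orbit_repr p)).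
have [w wE] : exists w, w = c (orbit_repr q) by exists (c (orbit_repr q)).
have Dv : half_space v by rewrite vE; exact: (half_space_chart_mapP I).
have Dw : half_space w by rewrite wE; exact: (half_space_chart_mapP I).
have [g Gg gwv] := denseG Dv Dw (mulr_gt0 r0 Dv).
pose f (z : C R) : 'rV[C R]_n.+1 := v + (z / toC r) *: (g w - v).
have fD z : unit_disc z -> half_space (f z).
  rewrite /unit_disc /= normRE -(toC1 R) ltC_toC => z1.
  rewrite /half_space /= !mxE ReImE.
  set d := g w ord0 ord0 - _; set d' := z / toC r * d.
  (* As [|z| < 1], the first coordinate moves by less than [normR d / r], which is below its
     imaginary part at [v]. *)
  have : normR d' < imC (v ord0 ord0).
    rewrite /d' normRM; apply: (@le_lt_trans _ _ (r^-1 * normR d)).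
      rewrite ler_wpM2r ?normR_ge0// normRM (_ : normR _^-1 = r^-1).
        by rewrite ler_piMl// ?invr_ge0 ltW.
      by rewrite -toCV normR_toC gtr0_norm ?invr_gt0.
    by rewrite ltr_pdivrMl.
  have := imC_le_normR d'; rewrite ler_norml => /andP[h _]; lra.
have df z : differentiable f z.
  apply: differentiableD; first exact: differentiable_cst.
  apply: differentiableZl; apply: differentiableM; last exact: differentiable_cst.
  exact: ex_diff.
have hf := orbit_disc_holomorphic domT pdG fD df.
have rC0 : toC r != 0 by apply/eqP => /(congr1 (@reC R)) /= rE; move: r0; rewrite rE ltxx.
have -> : p = orbit_proj (c := c) pdG (chart_inv c (f 0)).
  by rewrite /f mul0r scale0r addr0 vE chart_mapK// orbit_reprK.
have -> : q = orbit_proj (c := c) pdG (chart_inv c (f (toC r))).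
  rewrite /f divff// scale1r addrC subrK orbit_proj_act// wE chart_mapK//.
  by rewrite orbit_reprK.
apply: (@kobayashi_le_disc _ half_space_quotient _ 0 (toC r) hf); rewrite /unit_disc /=.
  by rewrite normr0 ltr01.
by rewrite norm_toC -(toC1 R) ltC_toC gtr0_norm.
Qed.

(** The covering manifold has the whole vector space as its topological space, hence is simply
    connected, and its chart maps it onto the half-space. *)
Lemma half_space_quotient_covered :
  exists (X : complexManifold R n.+1) (u : X -> half_space_quotient),
    universal_covering u /\ exists f : X -> 'rV[C R]_n.+1,
      biholomorphic_on (atlas X) (std_atlas 'rV[C R]_n.+1) setT (@half_space R n) f.
Proof.
exists (chart_manifold domT pdG (@norm_hausdorff _ _) (@rV_second_countable R n.+1)).
exists (@orbit_map _ _ _ _ _ domT pdG _ _); split.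
  by split; [exact: rV_simply_connected|exact: orbit_map_covering].
by exists (half_space_chart R n); exact: (chart_biholomorphic domT pdG).
Qed.

End kobayashi.

Theorem theorem4p1 (R : realType) :
  exists (n : nat) (Y' : complexManifold R n),
    (forall p q : Y', kobayashi p q = 0%E) /\
    exists (X : complexManifold R n) (u : X -> Y'),
      universal_covering u /\
      exists f : X -> 'rV[C R]_4,
        biholomorphic_on (atlas X) (std_atlas 'rV[C R]_4)
          setT (@halfplane_times_C3 R) f.
Proof.
have [x rx x12] := cubic_root_exists R.
exists 4, (half_space_quotient (deck_group_pd rx x12)); split.
  apply: half_space_quotient_kobayashi => v w e Dv Dw e0.
  have [m [n [c h]]] := deck_orbit_dense rx x12 Dv Dw e0.
  by exists (deck x m n c); [exists m, n, c|rewrite deckE].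
exact: half_space_quotient_covered.
Qed.
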